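(* Assume the setting and Assumptions A1, A2, A3 in the context, and let $n\ge1$. Define the effective sample size \[ \ell^\star:=\max\Big(\Big\{1\le\ell\le n:\ C_1\,\Phi_{\mathcal C}\big(\lfloor n/\ell\rfloor\big)\le \frac{c}{\ell}\vee\frac{\sigma}{\sqrt\ell}\Big\}\cup\{1\}\Big). \] Then for every $\nu\ge1$, \[ \mathbb P\left(\Big\|\frac1n\sum_{i=1}^nX_i\Big\|\ \ge\ \frac{\sigma\,(4A_1+6\sqrt B\sqrt\nu)}{\sqrt{\ell^\star}}+\frac{c\,(4A_1+M_1\nu)}{\ell^\star}\right)\le 2e^{-\nu}, \] where $B=A_1^2+A_2$ and $M_1=2+2\sqrt B\big(1+2\frac{C_2}{C_1c}\big)$.
   Context: Let $(\mathcal B,\|\cdot\|)$ be a separable real Banach space with dual $\mathcal B^\star$ (dual norm $\|\cdot\|_\star$, duality pairing $\langle\cdot,\cdot\rangle$). For $r>0$ let $B(r)$ and $B^\star(r)$ denote the closed balls of radius $r$ centered at $0$ in $\mathcal B$ and $\mathcal B^\star$. Fix $c>0$ and put $\mathcal X=B(c)$. Let $(X_i)_{i\ge1}$ be a stochastic process on a probability space $(\Omega,\mathcal F,\mathbb P)$ with values in $\mathcal X$ which is centered ($\mathbb E X_i=0$ for all $i$, Bochner expectation). Let $\mathcal M_i=\sigma(X_1,\dots,X_i)$. $\mathcal C$-mixing: let $\mathcal C$ be a closed subspace of the Banach space of bounded real-valued functions on $\mathcal X$ (with the supremum norm), let $C(\cdot)$ be a seminorm on $\mathcal C$, and $\mathcal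 C_1=\{f\in\mathcal C: C(f)\le 1\}$. For integers $k\ge1$ the $\mathcal C$-mixing coefficients are $\Phi_{\mathcal C}(k)=\sup\{\|\mathbb E[\varphi(X_{i+k})\mid\mathcal M_i]-\mathbb E[\varphi(X_{i+k})]\|_{L_\infty(\mathbb P)}:\ \varphi\in\mathcal C_1,\ i\ge1\}$. Gâteaux derivatives: for $f:\mathcal B\to\mathbb R$, $x\in\mathcal B$, $v\in\mathcal B$, $\delta_v f(x)=\frac{d}{dt}\big|_{t=0}f(x+tv)$ when it exists; $\delta_{v,v}f(x)=\frac{d^2}{dt^2}\big|_{t=0}f(x+tv)$ denotes the second Gâteaux differential in direction $v$. Assumption A1: the norm $x\mapsto\|x\|$ is twice Gâteaux differentiable at every nonzero $x$ in all directions, and there are constants $A_1\ge1$, $A_2>0$ with $|\delta_v(\|x\|)|\le A_1\|v\|$ and $|\delta_{v,v}(\|x\|)|\le A_2\|v\|^2/\|x\|$ for all $x,v\in\mathcal B$, $x\ne0$. Assumption A2: there are constants $c,\sigma^2>0$ with $\|X_i\|\le c$ a.s. and $\mathbb E\|X_i\|^2\le\sigma^2$ for all $i$ ($\sigma=\sqrt{\sigma^2}$). Assumption A3: for each $s\in\mathcal B^\star$ the function $h_{1,s}(x)=\langle s,x\rangle$ (restricted to $\mathcal X$) belongs to $\mathcal C$, the function $h_2(x)=\|x\|^2$ belongs to $\mathcal C$, and $\sup_{s\in B^\star(1)}C(h_{1,s})\le C_1$, $C(h_2)\le C_2$ for constants $C_1>0$, $C_2\ge0$. $a\vee b=\max(a,b)$.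 *)

(* Defs.v *)
From HB Require Import structures.
From mathcomp Require Import all_boot all_order all_algebra.
From mathcomp Require Import all_classical all_reals all_analysis ess_sup_inf.
Set Implicit Arguments. Unset Strict Implicit. Unset Printing Implicit Defensive.
Import Order.TTheory GRing.Theory Num.Theory.
Import numFieldNormedType.Exports.
Local Open Scope classical_set_scope.
Local Open Scope ring_scope.

Section defs.
Context {R : realType} {V : normedModType R}.

Definition separable_space : Prop :=
  exists D : set V, countable D /\ closure D = setT.

Definition is_dual (s : V -> R) : Prop :=
  (forall x y : V, s (x + y) = s x + s y) /\
  (forall (a : R) (x : V), s (a *: x) = a * s x) /\ continuous s.

Definition in_dual_ball1 (s : V -> R) : Prop :=
  is_dual s /\ forall x : V, `|s x| <= `|x|.

(* functions on X = B(c) are represented as functions V -> R vanishing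
   outside B(c); restrictX c f is the restriction of f to B(c). *)
Definition restrictX (c : R) (f : V -> R) : V -> R :=
  fun x => if `|x| <= c then f x else 0.

Definition normpath (x v : V) : R -> R := fun t => `|x + t *: v|.

Definition assumption_A1 (A1 A2 : R) : Prop :=
  1 <= A1 /\ 0 < A2 /\
  forall x v : V, x != 0 ->
    (\forall t \near 0, derivable (normpath x v) t 1) /\
    derivable (derive1 (normpath x v)) 0 1 /\
    `|derive1 (normpath x v) 0| <= A1 * `|v| /\
    `|derive1 (derive1 (normpath x v)) 0| <= A2 * `|v| ^+ 2 / `|x|.

Definition function_class (c : R) (Cc : set (V -> R)) (Cs : (V -> R) -> R)
  : Prop :=
  (forall f, Cc f -> restrictX c f = f) /\
  (forall f, Cc f -> exists M : R, forall x, `|f x| <= M) /\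
  Cc (fun _ => 0) /\
  (forall f g, Cc f -> Cc g -> Cc (f \+ g)) /\
  (forall (a : R) f, Cc f -> Cc (fun x => a * f x)) /\
  (forall (fn : nat -> V -> R) (f : V -> R),
     (forall m, Cc (fn m)) -> restrictX c f = f ->
     (forall e : R, 0 < e -> exists N : nat, forall m, (N <= m)%N ->
        forall x, `|fn m x - f x| <= e) -> Cc f) /\
  (forall f g, Cc f -> Cc g -> Cs (f \+ g) <= Cs f + Cs g) /\
  (forall (a : R) f, Cc f -> Cs (fun x => a * f x) = `|a| * Cs f).

End defs.

Section prob.
Context {R : realType} {V : normedModType R}
  {d : measure_display} {Omega : measurableType d}.
Variable P : probability Omega R.

Definition borel_meas (Y : Omega -> V) : Prop :=
  forall U : set V, open U -> measurable (Y @^-1` U).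

Definition natural_filtration (X : nat -> Omega -> V) (i : nat)
  : set (set Omega) :=
  <<s [set A | exists j U, (1 <= j <= i)%N /\ open U /\ A = X j @^-1` U] >>.

Definition cond_exp_version (G : set (set Omega)) (g Y : Omega -> R) : Prop :=
  (forall B : set R, measurable B -> G (Y @^-1` B)) /\
  P.-integrable setT (EFin \o Y) /\
  (forall A, G A -> (\int[P]_(w in A) (Y w)%:E = \int[P]_(w in A) (g w)%:E)%E).

Definition expect (g : Omega -> R) : R := fine (\int[P]_w (g w)%:E)%E.

Definition mixing_coeff (Cc : set (V -> R)) (Cs : (V -> R) -> R)
  (X : nat -> Omega -> V) (k : nat) : \bar R :=
  ereal_sup [set e | exists (phi : V -> R) (i : nat) (Y : Omega -> R),
    [/\ Cc phi, Cs phi <= 1, (1 <= i)%N,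
        cond_exp_version (natural_filtration X i) (phi \o X (i + k)%N) Y &
        e = ess_sup P (fun w => (`|Y w - expect (phi \o X (i + k)%N)|)%:E)]].

Definition eff_sample_size (Cc : set (V -> R)) (Cs : (V -> R) -> R)
  (X : nat -> Omega -> V) (C1 c sigma : R) (n : nat) : nat :=
  maxn 1 (\max_(l < n.+1 | (1 <= (l : nat))%N &&
     (C1%:E * mixing_coeff Cc Cs X (n %/ l) <=
        (Num.max (c / (l : nat)%:R) (sigma / Num.sqrt (l : nat)%:R))%:E)%E) (l : nat)).

End prob.

(* Main.v *)
Require Import Defs.
From HB Require Import structures.
From mathcomp Require Import all_boot all_order all_algebra.
From mathcomp Require Import all_classical all_reals all_analysis ess_sup_inf measurable_realfun.
From mathcomp Require Import ring lra.
Set Implicit Arguments. Unset Strict Implicit. Unset Printing Implicit Defensive.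
Import Order.TTheory GRing.Theory Num.Theory.
Import numFieldNormedType.Exports.
Local Open Scope classical_set_scope.
Local Open Scope ring_scope.

(* Let l be the effective sample size and k = n %/ l.  The indices 1..n split
   into k residue classes modulo k, each with at least l elements, and within a
   class consecutive elements are k apart.  As in Pinelis' method, for the
   partial sums S of a class and the next element Y, Taylor expansion of
   t |-> cosh (lam |S + t Y|) together with A1 gives
     cosh (lam |S + Y|) <= cosh (lam |S|) (1 + 4 B lam^2 |Y|^2)
                           + lam sinh (lam |S|) <D_S, Y>,
   with B = A1^2 + A2 and D_S the derivative of the norm at S.  Mixing bounds
   the conditional expectations of <D_S, Y> by C1 q and of |Y|^2 by
   sigma^2 + C2 q, where q bounds the k-th mixing coefficient.  Iterating along
   each class, averaging over the classes by Jensen's inequality, and optimising the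
   exponential Markov inequality over its parameter gives the claim. *)

(** * Hyperbolic functions and a Taylor bound *)

Section hyperbolic.
Context {R : realType}.
Implicit Types x y : R.

Definition cosh x : R := (expR x + expR (- x)) / 2.
Definition sinh x : R := (expR x - expR (- x)) / 2.

Lemma cosh_gt0 x : 0 < cosh x.
Proof. by rewrite /cosh; have := expR_gt0 x; have := expR_gt0 (- x); lra. Qed.

Lemma cosh0 : cosh 0 = 1.
Proof. by rewrite /cosh oppr0 expR0; lra. Qed.

Lemma sinh0 : sinh 0 = 0.
Proof. by rewrite /sinh oppr0 expR0 subrr mul0r. Qed.

Lemma coshN x : cosh (- x) = cosh x.
Proof. by rewrite /cosh opprK addrC. Qed.

Lemma cosh_norm x : cosh `|x| = cosh x.
Proof.
by have [x0|x0] := leP 0 x; [rewrite ger0_norm|rewrite ltr0_norm// coshN].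
Qed.

Global Instance is_derive_cosh x : is_derive x 1 cosh (sinh x).
Proof.
apply: is_derive_eq; rewrite /sinh /GRing.scale/=. lra.
Qed.

Global Instance is_derive_sinh x : is_derive x 1 sinh (cosh x).
Proof.
apply: is_derive_eq; rewrite /cosh /GRing.scale/=; lra.
Qed.

Lemma ler_cosh x y : 0 <= x -> x <= y -> cosh x <= cosh y.
Proof.
move=> x0 xy; rewrite /cosh ler_pM2r ?invr_gt0//.
have exy : expR x <= expR y by rewrite ler_expR.
have hx := expR_gt0 x; have hy := expR_gt0 y.
have e1 : 1 <= expR x by rewrite -expR0 ler_expR.
rewrite !expRN -subr_ge0.
have -> : expR y + (expR y)^-1 - (expR x + (expR x)^-1) =
  (expR y - expR x) * (1 - (expR x * expR y)^-1).
  by field; rewrite !gt_eqF.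
rewrite mulr_ge0 ?subr_ge0// invf_le1 ?mulr_gt0//; nra.
Qed.

(** Mean value theorem and monotonicity of [cosh]. The factor [x] later cancels the reciprocal of
    the norm in the second-order bound of A1. *)
Lemma sinh_le x : 0 <= x -> sinh x <= x * cosh x.
Proof.
rewrite le_eqVlt => /predU1P[<-|x0]; first by rewrite sinh0 mul0r.
have [|t] := @MVT R sinh cosh 0 x x0 (fun t _ => is_derive_sinh t).
  by apply: derivable_within_continuous => t _; exact: ex_derive.
rewrite in_itv/= => /andP[t0 tx]; rewrite sinh0 !subr0 => ->.
by rewrite mulrC ler_pM2l// ler_cosh// ltW.
Qed.

Lemma sinh_ge0 x : 0 <= x -> 0 <= sinh x.
Proof.
by move=> x0; rewrite /sinh divr_ge0// subr_ge0 ler_expR; lra.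
Qed.

Lemma sinh_le_cosh x : sinh x <= cosh x.
Proof. by rewrite /sinh /cosh; have := expR_gt0 (- x); lra. Qed.

(** Each of the two exponentials in [cosh] changes by a factor of at most exp |x - y|. *)
Lemma cosh_lip x y : cosh x <= cosh y * expR `|x - y|.
Proof.
rewrite /cosh mulrAC ler_pM2r ?invr_gt0// mulrDl -!expRD.
have h := ler_norm (x - y); have h' := ler_norm (y - x).
rewrite distrC in h'.
by apply: lerD; rewrite ler_expR; lra.
Qed.

(** Source of the constant 4 in the second-order bounds: exp (-1/2) >= 1/2 gives exp (1/2) <= 2. *)
Lemma expR_le4 x : x <= 1 -> expR x <= 4.
Proof.
move=> x1; apply: (@le_trans _ _ (expR (1/2 + 1/2))).
  by rewrite ler_expR; lra.
have h : (1 : R)/2 <= expR (-(1/2)) by have := expR_ge1Dx (-(1/2) : R); lra.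
have h0 := expR_gt0 (1/2 : R).
have e : expR (1/2) * expR (-(1/2)) = 1 :> R by rewrite -expRD subrr expR0.
have h2 : expR (1/2 : R) <= 2 by nra.
rewrite expRD; nra.
Qed.

(* f'' need not be integrable, so the mean value theorem is used twice, which
   costs the factor 1/2 in front of M. *)
Lemma taylor2_le (f : R -> R) (M : R) :
  (forall t, derivable f t 1) -> (forall t, derivable (derive1 f) t 1) ->
  0 <= M -> (forall t, 0 <= t <= 1 -> derive1 (derive1 f) t <= M) ->
  f 1 <= f 0 + derive1 f 0 + M.
Proof.
move=> df ddf M0 fM.
have [| |t] := @MVT R f (derive1 f) 0 1 ltr01.
- by move=> x _; rewrite derive1E; exact: derivableP.
- by apply: derivable_within_continuous => t _.
rewrite in_itv/= => /andP[t0 t1].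
have [| |u] := @MVT R (derive1 f) (derive1 (derive1 f)) 0 t t0.
- by move=> x _; rewrite [X in is_derive _ _ _ X]derive1E; exact: derivableP.
- by apply: derivable_within_continuous => x _.
rewrite in_itv/= => /andP[u0 ut] e1 e2.
have := fM u; rewrite (ltW u0)/= (ltW (lt_trans ut t1)) => /(_ isT) h.
nra.
Qed.

End hyperbolic.

(** * The Gateaux derivative of the norm *)

Section derive1_facts.
Context {R : realType}.

Lemma derive1_shift (f : R -> R) (t : R) :
  derive1 (fun u => f (u + t)) = (fun u => derive1 f (u + t)).
Proof.
apply/funext => u; rewrite /derive1; congr lim; apply: (congr1 (fun k => k @ _)).
by apply/funext => h; rewrite addrA.
Qed.

Lemma derivable_shift (f : R -> R) (t u : R) :
  derivable (fun u => f (u + t)) u 1 <-> derivable f (u + t) 1.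
Proof.
rewrite /derivable.
suff -> : (fun h : R => h^-1 *: (((fun u => f (u + t)) \o shift u) (h *: 1) - f (u + t)))
  = (fun h : R => h^-1 *: ((f \o shift (u + t)) (h *: 1) - f (u + t))) by [].
by apply/funext => h /=; rewrite addrA.
Qed.

Lemma derive1_global_min (f : R -> R) (a : R) :
  (\forall t \near a, derivable f t 1) -> (forall t, f a <= f t) ->
  derive1 f a = 0.
Proof.
move=> /nbhs_ballP[e /= e0 df] fa.
rewrite derive1E; apply: derive_val.
apply: (@derive1_at_min _ f (a - e) (a + e)) => //; first lra.
- move=> t; rewrite in_itv/= => h; apply: df.
  by rewrite /ball/= ltr_distlC; lra.
- by rewrite in_itv/=; lra.
Qed.

Lemma derive1_normr_le (f : R -> R) (k : R) : derivable f 0 1 ->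
  (forall h, `|f h - f 0| <= k * `|h|) -> `|derive1 f 0| <= k.
Proof.
move=> df fk; rewrite derive1E.
have h1 : `|h^-1 *: ((f \o shift 0) (h *: 1) - f 0)| @[h --> 0^'] --> `|'D_1 f 0|.
  exact: cvg_norm.
apply: (cvgr_to_le h1).
near=> h.
have h0 : h != 0 by near: h; exact: nbhs_dnbhs_neq.
rewrite /= addr0 normrM normfV ler_pdivrMl ?normr_gt0// mulrC.
rewrite [h *: 1]mulr1.
exact: fk.
Unshelve. all: by end_near.
Qed.

End derive1_facts.

Section gateaux.
Context {R : realType} {V : normedModType R}.
Variables A1 A2 : R.
Hypothesis HA : assumption_A1 (V := V) A1 A2.

Definition norm_gateaux (y v : V) : R := derive1 (normpath y v) 0.

Let near_derivable (y v : V) : y != 0 ->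
  \forall t \near 0, derivable (normpath y v) t 1.
Proof. by move=> y0; have [_ [_ /(_ y v y0)[]]] := HA. Qed.

Let derivable0 (y v : V) : y != 0 -> derivable (normpath y v) 0 1.
Proof. by move=> /near_derivable h; exact: (nbhs_singleton (h v)). Qed.

Lemma norm_gateauxZ (a : R) (y v : V) : y != 0 ->
  norm_gateaux y (a *: v) = a * norm_gateaux y v.
Proof.
move=> y0; rewrite /norm_gateaux.
have -> : normpath y (a *: v) = normpath y v \o ( *%R a).
  by apply/funext => t; rewrite /normpath/= scalerA mulrC.
have h1 : is_derive (0:R) 1 ( *%R a) a.
  by apply: is_derive_eq; rewrite /GRing.scale/= mulr1 ?mulr0 ?add0r ?addr0.
have h2 : is_derive (a * 0) 1 (normpath y v) (derive1 (normpath y v) 0).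
  by rewrite mulr0 derive1E; apply: derivableP; exact: derivable0.
rewrite derive1E; apply: derive_val.
by apply: is_derive_eq; rewrite /GRing.scale/= mulrC.
Qed.

(* By convexity of the norm the sum of the two half-speed paths minus the path
   in direction v + w is minimal at 0, so that its derivative vanishes. *)
Lemma norm_gateauxD (y v w : V) : y != 0 ->
  norm_gateaux y (v + w) = norm_gateaux y v + norm_gateaux y w.
Proof.
move=> y0.
pose g : R -> R := (2^-1 \*: normpath y (2 *: v) + 2^-1 \*: normpath y (2 *: w)
  - normpath y (v + w)).
have gE t : g t = 2^-1 * normpath y (2 *: v) t + 2^-1 * normpath y (2 *: w) t
  - normpath y (v + w) t by [].
have N0 x : normpath y x 0 = `|y| by rewrite /normpath scale0r addr0.
have g0 : derive1 g 0 = 0.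
  apply: derive1_global_min.
    apply: filterS3 (near_derivable (2 *: v) y0)
      (near_derivable (2 *: w) y0) (near_derivable (v + w) y0) => t h1 h2 h3.
    apply: derivableB h3; apply: derivableD; exact: derivableZ.
  move=> t.
  suff : normpath y (v + w) t <=
      2^-1 * normpath y (2 *: v) t + 2^-1 * normpath y (2 *: w) t.
    by rewrite !gE !N0; lra.
  rewrite /normpath.
  have e : y + t *: (v + w) =
      2^-1 *: (y + t *: (2 *: v)) + 2^-1 *: (y + t *: (2 *: w)).
    rewrite !scalerDr !scalerA (_ : 2^-1 * t * 2 = t); last by field.
    by rewrite [RHS]addrACA -scalerDl (_ : 2^-1 + 2^-1 = 1) ?scale1r//; field.
  have h : `|y + t *: (v + w)| <=
      2^-1 * `|y + t *: (2 *: v)| + 2^-1 * `|y + t *: (2 *: w)|.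
    by rewrite e (le_trans (ler_normD _ _))// !normrZ ger0_norm.
  exact: h.
have d1 : is_derive (0:R) 1 (normpath y (2 *: v)) (norm_gateaux y (2 *: v)).
  by rewrite /norm_gateaux derive1E; apply/derivableP/derivable0.
have d2 : is_derive (0:R) 1 (normpath y (2 *: w)) (norm_gateaux y (2 *: w)).
  by rewrite /norm_gateaux derive1E; apply/derivableP/derivable0.
have d3 : is_derive (0:R) 1 (normpath y (v + w)) (norm_gateaux y (v + w)).
  by rewrite /norm_gateaux derive1E; apply/derivableP/derivable0.
have : derive1 g 0 = 2^-1 * norm_gateaux y (2 *: v)
    + 2^-1 * norm_gateaux y (2 *: w) - norm_gateaux y (v + w).
  have dg := is_deriveB (is_deriveD (is_deriveZ 2^-1 d1) (is_deriveZ 2^-1 d2)) d3.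
  by rewrite derive1E (@derive_val _ _ _ _ _ _ _ dg).
rewrite g0 !norm_gateauxZ//; lra.
Qed.

(** The norm is 1-Lipschitz, so the constant is 1 instead of the [A1] of the assumption. This puts
    the derivative into the unit ball of the dual, where A3 controls the seminorm. *)
Lemma norm_gateaux_le (y v : V) : y != 0 -> `|norm_gateaux y v| <= `|v|.
Proof.
move=> y0; apply: derive1_normr_le; first exact: derivable0.
move=> h; rewrite /normpath scale0r addr0.
apply: (le_trans (ler_dist_dist _ _)).
by rewrite addrAC subrr add0r normrZ mulrC.
Qed.

Lemma norm_gateaux_dual (y : V) : y != 0 -> in_dual_ball1 (norm_gateaux y).
Proof.
move=> y0; split; last by move=> x; exact: norm_gateaux_le.
split; first by move=> v w; exact: norm_gateauxD.
split; first by move=> a v; exact: norm_gateauxZ.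
move=> x; apply/cvgrPdist_le => e e0; near=> z.
have -> : norm_gateaux y x - norm_gateaux y z = norm_gateaux y (x - z).
  by rewrite -[- z]scaleN1r norm_gateauxD// norm_gateauxZ// mulN1r.
apply: (le_trans (norm_gateaux_le _ y0)).
near: z; exact: (@cvgr_dist_le _ _ _ _ _ id x).
Unshelve. all: by end_near.
Qed.

End gateaux.

(** * Second-order bound for the hyperbolic cosine of the norm *)

Section smoothness.
Context {R : realType} {V : normedModType R}.
Variables A1 A2 : R.
Hypothesis HA : assumption_A1 (V := V) A1 A2.

Lemma is_derive_cosh_affine (b k t : R) :
  is_derive t 1 (fun u => cosh (b + k * u)) (k * sinh (b + k * t)).
Proof.
have h : is_derive t 1 (fun u => b + k * u) k.
  by apply: is_derive_eq; rewrite /GRing.scale/=; lra.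
have hc := is_derive_cosh (b + k * t).
rewrite (_ : (fun u => _) = cosh \o (fun u => b + k * u)); last by [].
by apply: is_derive_eq; rewrite /GRing.scale/= mulrC.
Qed.

Lemma is_derive_sinh_affine (b k t : R) :
  is_derive t 1 (fun u => k * sinh (b + k * u)) (k ^+ 2 * cosh (b + k * t)).
Proof.
have h : is_derive t 1 (fun u => b + k * u) k.
  by apply: is_derive_eq; rewrite /GRing.scale/=; lra.
have hc := is_derive_sinh (b + k * t).
rewrite (_ : (fun u => k * _) = k \*: (sinh \o (fun u => b + k * u))); last by [].
by apply: is_derive_eq; rewrite /GRing.scale/= expr2 -mulrA (mulrC k (cosh _)).
Qed.

(** On [0, 1] the argument moves by at most 1, so the second derivative k^2 cosh (b + k t) is at
    most 4 k^2 cosh b. The first-order term stays a [derive1] to match the case of lines off the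
    origin. *)
Lemma cosh_affine_taylor (b k : R) : `|k| <= 1 ->
  cosh (b + k) <= cosh b + derive1 (fun u => cosh (b + k * u)) 0 + 4 * k ^+ 2 * cosh b.
Proof.
move=> k1.
pose f u := cosh (b + k * u).
have df : derive1 f = (fun u => k * sinh (b + k * u)).
  by apply/funext => u; rewrite derive1E; apply: derive_val; exact: is_derive_cosh_affine.
have -> : cosh (b + k) = f 1 by rewrite /f mulr1.
have -> : cosh b = f 0 by rewrite /f mulr0 addr0.
apply: taylor2_le.
- by move=> t; exact: (@ex_derive _ _ _ _ _ _ _ (is_derive_cosh_affine b k t)).
- move=> t; rewrite [X in derivable X]df.
  exact: (@ex_derive _ _ _ _ _ _ _ (is_derive_sinh_affine b k t)).
- by rewrite mulr_ge0 ?(ltW (cosh_gt0 _))// mulr_ge0// sqr_ge0.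
- move=> t /andP[t0 t1].
  have -> : derive1 (derive1 f) t = k ^+ 2 * cosh (b + k * t).
    rewrite derive1E df; exact: (@derive_val _ _ _ _ _ _ _ (is_derive_sinh_affine b k t)).
  rewrite /f mulr0 addr0 (mulrC 4) -[leRHS]mulrA ler_wpM2l ?sqr_ge0//.
  apply: (le_trans (cosh_lip _ b)); rewrite mulrC ler_wpM2r ?(ltW (cosh_gt0 _))//.
  apply: expR_le4; rewrite addrC addKr normrM (ger0_norm t0).
  by rewrite (le_trans _ k1)// ler_piMr.
Qed.

Lemma normpath_shift (y v : V) (t : R) :
  normpath y v = (fun u => normpath (y + t *: v) v (u + (- t))).
Proof.
by apply/funext => u; rewrite /normpath -addrA -scalerDl addrCA subrr addr0.
Qed.

(** A1 speaks of time 0 only; recentring the path at its point of time [t] carries it to every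
    time. *)
Lemma normpath_off0 (y v : V) : (forall t, y + t *: v != 0) ->
  [/\ forall t, derivable (normpath y v) t 1,
      forall t, derivable (derive1 (normpath y v)) t 1,
      forall t, `|derive1 (normpath y v) t| <= A1 * `|v| &
      forall t, `|derive1 (derive1 (normpath y v)) t|
                <= A2 * `|v| ^+ 2 / normpath y v t].
Proof.
move=> yv.
have H t : [/\ derivable (normpath y v) t 1, derivable (derive1 (normpath y v)) t 1,
      `|derive1 (normpath y v) t| <= A1 * `|v| &
      `|derive1 (derive1 (normpath y v)) t| <= A2 * `|v| ^+ 2 / normpath y v t].
  have [_ [_ /(_ _ v (yv t))[/nbhs_singleton d1 [d2 [n1 n2]]]]] := HA.
  have e := normpath_shift y v t; set g := normpath (y + t *: v) v in e d1 d2 n1 n2.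
  have e1 : derive1 (normpath y v) = (fun u => derive1 g (u + - t)).
    by rewrite e; exact: derive1_shift.
  have e2 : derive1 (derive1 (normpath y v)) = (fun u => derive1 (derive1 g) (u + - t)).
    by rewrite e1; exact: derive1_shift.
  rewrite e2 e1; split.
  - rewrite e; apply: (proj2 (@derivable_shift _ g (- t) t)); rewrite subrr; exact: d1.
  - apply: (proj2 (@derivable_shift _ (derive1 g) (- t) t)); rewrite subrr; exact: d2.
  - by rewrite subrr.
  - by rewrite subrr.
by split=> t; have [] := H t.
Qed.

Lemma is_derive_cosh_normpath (lam : R) (y v : V) (t : R) :
  derivable (normpath y v) t 1 ->
  is_derive t 1 (fun u => cosh (lam * normpath y v u))
    (lam * sinh (lam * normpath y v t) * derive1 (normpath y v) t).
Proof.
move=> dN.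
have h : is_derive t 1 (normpath y v) (derive1 (normpath y v) t).
  by rewrite derive1E; exact: derivableP.
have h' : is_derive t 1 (fun u => lam * normpath y v u)
    (lam * derive1 (normpath y v) t).
  exact: (is_deriveZ lam h).
have hc := is_derive_cosh (lam * normpath y v t).
rewrite (_ : (fun u => _) = cosh \o (fun u => lam * normpath y v u)); last by [].
by apply: is_derive_eq; rewrite /GRing.scale/=; ring.
Qed.

(** With N the norm along the path and f = cosh (lam N), f'' = lam^2 cosh (lam N) N'^2 + lam sinh
    (lam N) N''. A1 bounds this by (A1^2 + A2) (lam |v|)^2 f, and f <= 4 f(0) on [0, 1] because lam
    N moves by at most 1. *)
Lemma cosh_norm_taylor_off0 (lam : R) (y v : V) : 0 < lam -> lam * `|v| <= 1 ->
  (forall t, y + t *: v != 0) ->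
  cosh (lam * `|y + v|) <= cosh (lam * `|y|)
   + derive1 (fun u => cosh (lam * normpath y v u)) 0
   + 4 * (A1 ^+ 2 + A2) * (lam * `|v|) ^+ 2 * cosh (lam * `|y|).
Proof.
move=> lam0 lv yv.
have [A1ge [A2gt _]] := HA.
have [d1 d2 n1 n2] := normpath_off0 yv.
pose N := normpath y v; pose f u := cosh (lam * N u).
have df : derive1 f = (fun t => lam * sinh (lam * N t) * derive1 N t).
  apply/funext => u; rewrite derive1E; apply: derive_val.
  exact: is_derive_cosh_normpath.
have ddf (t : R) : is_derive t 1 (derive1 f)
   (lam ^+ 2 * cosh (lam * N t) * derive1 N t ^+ 2
    + lam * sinh (lam * N t) * derive1 (derive1 N) t).
  rewrite df.
  have h : is_derive t 1 N (derive1 N t).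
    by rewrite derive1E; exact: derivableP.
  have h2 : is_derive t 1 (derive1 N) (derive1 (derive1 N) t).
    by rewrite [X in is_derive _ _ _ X]derive1E; exact: derivableP.
  have h' : is_derive t 1 (fun u => lam * N u) (lam * derive1 N t).
    exact: (is_deriveZ lam h).
  have hc := is_derive_sinh (lam * N t).
  have hs : is_derive t 1 (fun u => lam * sinh (lam * N u))
      (lam * (cosh (lam * N t) * (lam * derive1 N t))).
    exact: (is_deriveZ lam (@is_derive1_comp _ sinh (fun u => lam * N u) t _ _ hc h')).
  apply: (is_derive_eq (is_deriveM hs h2)).
  by rewrite /GRing.scale/=; ring.
have -> : cosh (lam * `|y + v|) = f 1 by rewrite /f /N /normpath scale1r.
have -> : cosh (lam * `|y|) = f 0 by rewrite /f /N /normpath scale0r addr0.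
apply: taylor2_le.
- by move=> t; exact: (@ex_derive _ _ _ _ _ _ _ (is_derive_cosh_normpath lam (d1 t))).
- by move=> t; exact: (@ex_derive _ _ _ _ _ _ _ (ddf t)).
- have B0 : 0 <= 4 * (A1 ^+ 2 + A2) by have := sqr_ge0 A1; lra.
  exact: mulr_ge0 (mulr_ge0 B0 (sqr_ge0 _)) (ltW (cosh_gt0 _)).
move=> t /andP[t0 t1].
rewrite [X in X <= _]derive1E (@derive_val _ _ _ _ _ _ _ (ddf t)).
have Nt0 : 0 < N t by rewrite /N /normpath normr_gt0.
have f0 : 0 < f 0 by exact: cosh_gt0.
have ft : f t <= 4 * f 0.
  rewrite /f; apply: (le_trans (cosh_lip _ (lam * N 0))); rewrite mulrC.
  rewrite ler_wpM2r ?(ltW (cosh_gt0 _))//; apply: expR_le4.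
  rewrite -mulrBr normrM (gtr0_norm lam0); apply: le_trans lv.
  rewrite ler_pM2l// /N /normpath scale0r addr0.
  rewrite (le_trans (ler_dist_dist _ _))// addrAC subrr add0r normrZ.
  by rewrite (ger0_norm t0) ler_piMl.
have b1 : lam ^+ 2 * f t * derive1 N t ^+ 2 <= A1 ^+ 2 * (lam * `|v|) ^+ 2 * f t.
  have : derive1 N t ^+ 2 <= (A1 * `|v|) ^+ 2.
    rewrite -[derive1 N t ^+ 2]real_normK ?num_real//.
    by rewrite lerXn2r ?nnegrE// mulr_ge0//; lra.
  move=> h; rewrite [leRHS](_ : _ = lam ^+ 2 * f t * (A1 * `|v|) ^+ 2); last by ring.
  by rewrite ler_wpM2l// (mulr_ge0 (sqr_ge0 _) (ltW (cosh_gt0 _))).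
(* Here sinh (lam N) <= lam N cosh (lam N) absorbs the division by N in the bound on N''. *)
have b2 : lam * sinh (lam * N t) * derive1 (derive1 N) t
    <= A2 * (lam * `|v|) ^+ 2 * f t.
  have h := n2 t; have hs := sinh_le (ltW (mulr_gt0 lam0 Nt0)).
  have s0 := sinh_ge0 (ltW (mulr_gt0 lam0 Nt0)).
  apply: (@le_trans _ _ (lam * (lam * N t * f t) * (A2 * `|v| ^+ 2 / N t))).
    apply: (le_trans (ler_norm _)); rewrite normrM.
    apply: ler_pM => //; rewrite ger0_norm ?ler_pM2l// mulr_ge0// ltW//.
  by rewrite le_eqVlt; apply/orP; left; apply/eqP; field; rewrite gt_eqF.
apply: (le_trans (lerD b1 b2)).
rewrite -!mulrDl.
rewrite -[leRHS](_ : (A1 ^+ 2 + A2) * (lam * `|v|) ^+ 2 * (4 * f 0) = _);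
  last by ring.
by rewrite ler_wpM2l// (mulr_ge0 (addr_ge0 (sqr_ge0 _) (ltW A2gt)) (sqr_ge0 _)).
Qed.

(* Along a line through the origin the norm is not differentiable, but there
   t |-> cosh (lam |y + t v|) is a translated dilated cosh. *)
Lemma cosh_norm_taylor_through0 (lam : R) (y v : V) (t0 : R) :
  0 < lam -> lam * `|v| <= 1 -> y + t0 *: v = 0 ->
  cosh (lam * `|y + v|) <= cosh (lam * `|y|)
   + derive1 (fun u => cosh (lam * normpath y v u)) 0
   + 4 * (A1 ^+ 2 + A2) * (lam * `|v|) ^+ 2 * cosh (lam * `|y|).
Proof.
move=> lam0 lv yv.
have [A1ge [A2gt _]] := HA.
have ey : y = - t0 *: v by apply/eqP; rewrite scaleNr -addr_eq0 yv.
pose k := lam * `|v|; pose b := - t0 * k.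
have e u : cosh (lam * normpath y v u) = cosh (b + k * u).
  rewrite /normpath ey -scalerDl normrZ -[RHS]cosh_norm; congr cosh.
  rewrite /b (mulrC k) -mulrDl normrM /k.
  by rewrite (ger0_norm (mulr_ge0 (ltW lam0) (normr_ge0 v))) mulrCA.
have := @cosh_affine_taylor b k; rewrite /k ger0_norm ?mulr_ge0 ?(ltW lam0)//.
move=> /(_ lv); rewrite -/k.
under eq_fun do rewrite -e.
have -> : cosh (b + k) = cosh (lam * `|y + v|).
  by rewrite -[k in LHS]mulr1 -e /normpath scale1r.
have -> : cosh b = cosh (lam * `|y|).
  by rewrite -[b]addr0 -[0](mulr0 k) -e /normpath scale0r addr0.
(* The affine case has the constant 4, which is at most 4 (A1^2 + A2) because A1 >= 1. *)
move=> /le_trans; apply; rewrite lerD2l ler_wpM2r ?(ltW (cosh_gt0 _))//.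
by rewrite ler_wpM2r ?sqr_ge0//; nra.
Qed.

(** The functional [s] depends on [y] but not on [v], so [v] can be integrated with [y] fixed. For y
    = 0 the zero functional serves, since the first-order term vanishes with sinh 0. *)
Lemma cosh_norm_taylor (lam : R) (y : V) : 0 < lam ->
  exists2 s : V -> R, in_dual_ball1 s & forall v, lam * `|v| <= 1 ->
  cosh (lam * `|y + v|) <= cosh (lam * `|y|)
   + lam * sinh (lam * `|y|) * s v
   + 4 * (A1 ^+ 2 + A2) * (lam * `|v|) ^+ 2 * cosh (lam * `|y|).
Proof.
move=> lam0.
have T v : lam * `|v| <= 1 -> cosh (lam * `|y + v|) <= cosh (lam * `|y|)
   + derive1 (fun u => cosh (lam * normpath y v u)) 0
   + 4 * (A1 ^+ 2 + A2) * (lam * `|v|) ^+ 2 * cosh (lam * `|y|).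
  move=> lv; have [[t0 yt0]|H] := pselect (exists t, y + t *: v = 0).
    exact: cosh_norm_taylor_through0 yt0.
  by apply: cosh_norm_taylor_off0 => // t; apply/eqP => ht; apply: H; exists t.
have [y0|y0] := eqVneq y 0.
  exists (fun=> 0).
    split; last by move=> x; rewrite normr0.
    split; first by move=> ? ?; rewrite addr0.
    by split; [move=> ? ?; rewrite mulr0|exact: cst_continuous].
  move=> v lv; apply: (le_trans (T v lv)); rewrite lerD2r lerD2l mulr0.
  rewrite derive1E; suff -> : (fun u => cosh (lam * normpath y v u)) =
      (fun u => cosh (0 + lam * `|v| * u)).
    by rewrite (@derive_val _ _ _ _ _ _ _ (is_derive_cosh_affine 0 (lam * `|v|) 0))
      mulr0 addr0 sinh0 mulr0.
  apply/funext => u; rewrite add0r /normpath y0 add0r normrZ.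
  have lv0 : 0 <= lam * `|v| by rewrite mulr_ge0// ltW.
  by rewrite -[RHS]cosh_norm normrM (ger0_norm lv0) -[in RHS]mulrA (mulrC `|v|).
exists (norm_gateaux y); first exact: (norm_gateaux_dual HA).
move=> v lv; apply: (le_trans (T v lv)); rewrite lerD2r lerD2l.
have [_ [_ /(_ _ v y0)[/nbhs_singleton d1 _]]] := HA.
rewrite derive1E (@derive_val _ _ _ _ _ _ _ (is_derive_cosh_normpath lam d1)).
by rewrite {1}/normpath scale0r addr0.
Qed.

End smoothness.

(** * Conditional expectation *)

Section conditional_expectation.
Context {R : realType} {d : measure_display} {Omega : measurableType d}.
Variable P : probability Omega R.

(** [Y] is the Radon-Nikodym derivative, with respect to the law of [f], of the image under [f] of
    the signed measure with density [g]. *)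
Lemma cond_exp_map (d' : measure_display) (T : measurableType d')
    (f : Omega -> T) (g : Omega -> R) :
  measurable_fun setT f -> P.-integrable setT (EFin \o g) ->
  exists Y : T -> R, [/\ measurable_fun setT Y,
    P.-integrable setT (EFin \o (Y \o f)) &
    forall A, measurable A ->
      (\int[P]_(w in f @^-1` A) (Y (f w))%:E
       = \int[P]_(w in f @^-1` A) (g w)%:E)%E].
Proof.
move=> mf intg.
pose F : {mfun Omega >-> T} := mfun_Sub (mem_set mf).
pose P' : probability T R := distribution P F.
pose nu0 : {charge set Omega -> \bar R} := induced_charge intg.
pose nu1 : {charge set T -> \bar R} := @pushforward _ _ Omega T R nu0 F.
pose nu := nu1 mf.
have mfA A : measurable A -> measurable (f @^-1` A).
  by move=> mA; rewrite -[X in measurable X]setTI; exact: (mf measurableT A mA).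
have nuE A : nu A = (\int[P]_(w in f @^-1` A) (g w)%:E)%E by [].
have dom : nu `<< P'.
  apply/null_content_dominatesP => A mA PA.
  rewrite nuE; apply: null_set_integral => //; first exact: mfA.
  by apply: measurable_funTS; exact: (measurable_int P intg).
pose Y' : T -> \bar R := Radon_Nikodym nu P'.
have intY' : P'.-integrable setT Y' by exact: Radon_Nikodym_integrable.
have mY' : measurable_fun setT Y' by exact: (measurable_int P' intY').
have YE : EFin \o (fine \o Y') = Y'.
  by apply/funext => w; rewrite /= fineK//; exact: Radon_Nikodym_fin_num.
have YfE : EFin \o ((fine \o Y') \o f) = Y' \o f by rewrite -[in RHS]YE.
have intY : P.-integrable setT (Y' \o f).
  apply/integrableP; split; first exact: measurableT_comp.
  move/integrableP : intY' => [_].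
  by rewrite ge0_integral_pushforward//; exact: measurableT_comp.
exists (fine \o Y'); split.
- exact: measurableT_comp.
- by rewrite YfE.
- move=> A mA; rewrite -nuE (Radon_Nikodym_integral dom)//.
  under eq_integral do rewrite -[_%:E]/((EFin \o ((fine \o Y') \o f)) _) YfE.
  rewrite -[RHS]/(\int[pushforward P f]_(x in A) Y' x)%E integral_pushforward//.
  exact: (integrableS measurableT (mfA A mA) (@subsetT _ _) intY).
Qed.

(** The previous lemma for the identity map into [Omega] with the smaller sigma-algebra. Since
    [mixing_coeff] is a supremum over versions, it gives a bound only once a version is known to
    exist. *)
Lemma cond_exp_exists (G0 : set (set Omega)) (g : Omega -> R) :
  G0 `<=` measurable -> P.-integrable setT (EFin \o g) ->
  exists Y, cond_exp_version P <<s G0 >> g Y.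
Proof.
move=> G0m intg.
have Gm : <<s G0 >> `<=` @measurable _ Omega.
  apply: smallest_sub => //; split => //.
  - by move=> A mA; rewrite setTD; exact: measurableC.
  - by move=> F mF; exact: bigcup_measurable.
have mf : measurable_fun setT (id : Omega -> g_sigma_algebraType G0).
  by move=> _ B mB; rewrite setTI; exact: Gm.
have [Y [mY intY YE]] := cond_exp_map mf intg.
exists Y; split => //.
by move=> B mB; have := mY measurableT B mB; rewrite setTI.
Qed.

End conditional_expectation.

(** * Mixing on events of the past *)

Section mixing.
Context {R : realType} {V : normedModType R}
  {d : measure_display} {Omega : measurableType d}.
Variable P : probability Omega R.

Lemma bounded_integrable (f : Omega -> R) (M : R) :
  measurable_fun setT f -> (forall w, `|f w| <= M) ->
  P.-integrable setT (EFin \o f).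
Proof.
move=> mf fM; apply: measurable_bounded_integrable => //.
  by rewrite (le_lt_trans (probability_le1 _ _))// ltry.
by exists M; split; rewrite ?num_real// => x Mx w _ /=; rewrite (le_trans (fM w))// ltW.
Qed.

Lemma natural_filtration_measurable (X : nat -> Omega -> V) (i : nat) :
  (forall j, (1 <= j)%N -> borel_meas (X j)) ->
  [set A | exists j U, (1 <= j <= i)%N /\ open U /\ A = X j @^-1` U]
    `<=` @measurable _ Omega.
Proof. by move=> mX _ [j [U [/andP[j1 _] [oU ->]]]]; exact: mX. Qed.

Lemma sigma_algebra_measurable : sigma_algebra setT (@measurable _ Omega).
Proof.
split => //.
- by move=> A mA; rewrite setTD; exact: measurableC.
- by move=> F mF; exact: bigcup_measurable.
Qed.

Lemma natural_filtration_sub (X : nat -> Omega -> V) (i : nat) :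
  (forall j, (1 <= j)%N -> borel_meas (X j)) ->
  natural_filtration X i `<=` @measurable _ Omega.
Proof.
move=> mX; apply: smallest_sub; first exact: sigma_algebra_measurable.
exact: natural_filtration_measurable.
Qed.

Lemma ae_integral_le (A : set Omega) (Y : Omega -> R) (a : R) :
  measurable A -> P.-integrable setT (EFin \o Y) ->
  (\forall w \ae P, Y w <= a) ->
  (\int[P]_(w in A) (Y w)%:E <= a%:E * P A)%E.
Proof.
move=> mA intY [N [mN PN0 NY]].
have intA : P.-integrable A (EFin \o Y).
  exact: (integrableS measurableT mA (@subsetT _ _) intY).
have intc : P.-integrable A (EFin \o cst a).
  exact: finite_measure_integrable_cst.
rewrite (@negligible_integral _ _ _ _ A N (EFin \o Y))//.
rewrite -(@integral_cst _ _ _ P A mA a%:E).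
rewrite [leRHS](@negligible_integral _ _ _ _ A N (EFin \o cst a))//.
have mAN : measurable (A `\` N) by exact: measurableD.
apply: le_integral => //.
- exact: (integrableS mA mAN (@subDsetl _ _ _) intA).
- exact: (integrableS mA mAN (@subDsetl _ _ _) intc).
- move=> w; rewrite inE => -[_ Nw] /=; rewrite lee_fin.
  by apply: contrapT => h; exact/Nw/NY.
Qed.

Variables (X : nat -> Omega -> V) (c : R) (Cc : set (V -> R)) (Cs : (V -> R) -> R).
Hypothesis mX : forall i, (1 <= i)%N -> borel_meas (X i).
Hypothesis HC : function_class c Cc Cs.
Hypothesis mC : forall phi i, Cc phi -> (1 <= i)%N ->
  measurable_fun setT (phi \o X i).

Lemma class_integrable (phi : V -> R) (i : nat) : Cc phi -> (1 <= i)%N ->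
  P.-integrable setT (EFin \o (phi \o X i)).
Proof.
move=> Cphi i1; have [_ [/(_ _ Cphi)[M hM] _]] := HC.
by apply: (@bounded_integrable _ M); [exact: mC|move=> w; exact: hM].
Qed.

(** On an event of the past, [phi] may be replaced by a version of its conditional expectation,
    which exceeds the mean by at most [q] almost surely. *)
Lemma mixing_le1 (q : R) (k i : nat) (phi : V -> R) (A : set Omega) :
  (mixing_coeff P Cc Cs X k <= q%:E)%E -> (1 <= i)%N ->
  Cc phi -> Cs phi <= 1 -> natural_filtration X i A ->
  (\int[P]_(w in A) (phi (X (i + k)%N w))%:E
    <= (expect P (phi \o X (i + k)%N) + q)%:E * P A)%E.
Proof.
move=> hq i1 Cphi Cs1 FA.
have ik1 : (1 <= i + k)%N by rewrite addn_gt0 i1.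
have [Y HY] := cond_exp_exists (natural_filtration_measurable (i := i) mX)
  (class_integrable Cphi ik1).
have [_ [intY YE]] := HY.
rewrite -(YE _ FA); apply: ae_integral_le => //.
  exact: natural_filtration_sub FA.
have : (ess_sup P (fun w => (`|Y w - expect P (phi \o X (i + k)%N)|)%:E)
    <= q%:E)%E.
  by apply: le_trans hq; apply: ereal_sup_ubound; exists phi, i, Y.
move=> /ess_supP; apply: filterS => w; rewrite lee_fin => h.
by rewrite -lerBlDl (le_trans (ler_norm _)).
Qed.

(** Dividing [phi] by some L > 0 with Cs phi <= L reduces to seminorm at most 1. As [K] may be 0, L
    is taken slightly above [K] and the excess tends to 0. *)
Lemma mixing_le (q K : R) (k i : nat) (phi : V -> R) (A : set Omega) :
  0 <= q -> (mixing_coeff P Cc Cs X k <= q%:E)%E -> (1 <= i)%N ->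
  Cc phi -> Cs phi <= K -> 0 <= K -> natural_filtration X i A ->
  (\int[P]_(w in A) (phi (X (i + k)%N w))%:E
    <= (expect P (phi \o X (i + k)%N) + K * q)%:E * P A)%E.
Proof.
move=> q0 hq i1 Cphi CsK K0 FA.
have ik1 : (1 <= i + k)%N by rewrite addn_gt0 i1.
have mA : measurable A by exact: natural_filtration_sub FA.
have intphi := class_integrable Cphi ik1.
have intA : P.-integrable A (EFin \o (phi \o X (i + k)%N)).
  exact: (integrableS measurableT mA (@subsetT _ _) intphi).
have PA : P A \is a fin_num by exact: fin_num_measure.
have IA := integrable_fin_num mA intA.
have IT := integrable_fin_num measurableT intphi.
have step (L : R) : 0 < L -> Cs phi <= L ->
    fine (\int[P]_(w in A) (phi (X (i + k)%N w))%:E)%E <=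
    (expect P (phi \o X (i + k)%N) + L * q) * fine (P A).
  move=> L0 CsL; have [_ [_ [_ [_ [CZ [_ [_ CsZ]]]]]]] := HC.
  have := @mixing_le1 q k i (fun x => L^-1 * phi x) A hq i1 (CZ _ _ Cphi).
  rewrite CsZ// ger0_norm ?invr_ge0 ?(ltW L0)// ler_pdivrMl// mulr1.
  move=> /(_ CsL FA); rewrite /expect/=.
  under eq_integral do rewrite EFinM.
  rewrite (integralZl mA intA).
  under [X in fine X]eq_integral do rewrite EFinM.
  rewrite (integralZl measurableT intphi) fineM//.
  rewrite -(fineK PA) -(fineK IA) -!EFinM lee_fin ler_pdivrMl//.
  move=> /le_trans; apply; rewrite le_eqVlt; apply/orP; left; apply/eqP.
  by rewrite /=; field; rewrite gt_eqF.
rewrite -(fineK PA) -(fineK IA) -EFinM lee_fin.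
have p0 : 0 <= fine (P A) by rewrite fine_ge0.
apply/ler_addgt0Pr => e e0.
(* The summand 1 keeps the denominator positive when q P(A) = 0; the excess of L over [K] then
   contributes at most [e]. *)
have qp : 0 < q * fine (P A) + 1 by rewrite ltr_wpDl// mulr_ge0.
have e'0 : 0 < e / (q * fine (P A) + 1) by rewrite divr_gt0.
apply: (le_trans (@step (K + e / (q * fine (P A) + 1)) _ _)).
- by rewrite ltr_wpDl.
- by rewrite (le_trans CsK)// lerDl ltW.
rewrite (mulrDl K) addrA mulrDl lerD2l -mulrA mulrAC ler_pdivrMr//.
by rewrite ler_pM2l// lerDl.
Qed.

Lemma mixing_dual_le (q C1 : R) (k i : nat) (s : V -> R) (A : set Omega) :
  0 <= q -> (mixing_coeff P Cc Cs X k <= q%:E)%E -> (1 <= i)%N ->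
  (forall w, `|X (i + k)%N w| <= c) ->
  0 <= C1 -> Cc (restrictX c s) -> Cs (restrictX c s) <= C1 ->
  expect P (s \o X (i + k)%N) = 0 -> natural_filtration X i A ->
  (\int[P]_(w in A) (s (X (i + k)%N w))%:E <= (C1 * q)%:E * P A)%E.
Proof.
move=> q0 hq i1 Xc C10 Cphi CsK E0 FA.
have e w : restrictX c s (X (i + k)%N w) = s (X (i + k)%N w).
  by rewrite /restrictX Xc.
have := mixing_le q0 hq i1 Cphi CsK C10 FA.
under eq_integral do rewrite e.
rewrite (_ : restrictX c s \o X (i + k)%N = s \o X (i + k)%N); last exact/funext.
by rewrite E0 add0r.
Qed.

Lemma mixing_sqr_le (q C2 sigma : R) (k i : nat) (A : set Omega) :
  0 <= q -> (mixing_coeff P Cc Cs X k <= q%:E)%E -> (1 <= i)%N ->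
  (forall w, `|X (i + k)%N w| <= c) ->
  0 <= C2 -> Cc (restrictX c (fun x => `|x| ^+ 2)) ->
  Cs (restrictX c (fun x => `|x| ^+ 2)) <= C2 ->
  (\int[P]_w (`|X (i + k)%N w| ^+ 2)%:E <= (sigma ^+ 2)%:E)%E ->
  natural_filtration X i A ->
  (\int[P]_(w in A) (`|X (i + k)%N w| ^+ 2)%:E
    <= (sigma ^+ 2 + C2 * q)%:E * P A)%E.
Proof.
move=> q0 hq i1 Xc C20 Cphi CsK Es FA.
have e w : restrictX c (fun x => `|x| ^+ 2) (X (i + k)%N w) = `|X (i + k)%N w| ^+ 2.
  by rewrite /restrictX Xc.
have := mixing_le q0 hq i1 Cphi CsK C20 FA.
under eq_integral do rewrite e.
move=> /le_trans; apply; rewrite lee_wpmul2r// lee_fin lerD2r /expect.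
under eq_integral do rewrite /= e.
have ik1 : (1 <= i + k)%N by rewrite addn_gt0 i1.
have := integrable_fin_num measurableT (class_integrable Cphi ik1).
under eq_integral do rewrite /= e.
by move=> h; rewrite -lee_fin fineK.
Qed.

End mixing.

(** * Borel maps into a separable space *)

Section borel.
Context {R : realType} {V : normedModType R}
  {d : measure_display} {Omega : measurableType d}.

Lemma dense_sequence : separable_space (V := V) ->
  exists y : nat -> V, forall x e, 0 < e -> exists n, `|x - y n| < e.
Proof.
move=> [D [/pcard_surjP[y yD] clD]]; exists y => x e e0.
have : closure D x by rewrite clD.
move=> /(_ (ball x e) (nbhsx_ballx x e e0)) [z [Dz]].
rewrite -ball_normE/= => xz.
by have [n _ ynz] := yD z Dz; exists n; rewrite ynz.
Qed.

Lemma borel_meas_cst (y : V) : borel_meas (fun _ : Omega => y).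
Proof.
move=> U oU; have [Uy|Uy] := pselect (U y).
  by rewrite (_ : _ @^-1` _ = setT)//; apply/seteqP; split.
by rewrite (_ : _ @^-1` _ = set0)//; apply/seteqP; split.
Qed.

(** By separability, the pairs whose sum lies in [U] form a countable union of products of balls
    centred on a dense sequence. *)
Lemma borel_measD (Y Z : Omega -> V) : separable_space (V := V) ->
  borel_meas Y -> borel_meas Z -> borel_meas (fun w => Y w + Z w).
Proof.
move=> /dense_sequence[y yd] mY mZ U oU.
pose good m n p := forall a b, ball (y m) p.+1%:R^-1 a ->
  ball (y n) p.+1%:R^-1 b -> U (a + b).
pose E m n p := if pselect (good m n p) then
  Y @^-1` ball (y m) p.+1%:R^-1 `&` Z @^-1` ball (y n) p.+1%:R^-1 else set0.
have -> : (fun w => Y w + Z w) @^-1` U = \bigcup_m \bigcup_n \bigcup_p E m n p.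
  apply/seteqP; split => w /=; last first.
    move=> [m _ [n _ [p _]]]; rewrite /E; case: pselect => // g [h1 h2].
    exact: g.
  move=> Uw.
  have : nbhs (Y w + Z w) U by exact: open_nbhs_nbhs.
  move=> /nbhs_ballP[e /= e0 eU].
  (* A quarter, because four distances add up: from Y w to y m to a, and from Z w to y n to b. *)
  have [p hp] : exists p, p.+1%:R^-1 < e / 4.
    have e40 : 0 < e / 4 by rewrite divr_gt0.
    exists (Num.truncn (e / 4)^-1).
    by rewrite invf_plt ?posrE// truncnS_gt.
  have p0 : 0 < p.+1%:R^-1 :> R by rewrite invr_gt0.
  have [m hm] := yd (Y w) _ p0.
  have [n hn] := yd (Z w) _ p0.
  exists m => //; exists n => //; exists p => //; rewrite /E.
  case: pselect => [g|]; first by split; rewrite /= -ball_normE/= distrC.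
  case=> a b; rewrite -!ball_normE/= => ha hb; apply: eU.
  rewrite -ball_normE/=.
  have -> : Y w + Z w - (a + b) =
     (Y w - y m) + (y m - a) + ((Z w - y n) + (y n - b)).
    by rewrite !addrA !subrK opprD addrACA !addrA.
  apply: (le_lt_trans (ler_normD _ _)).
  have h1 := ler_normD (Y w - y m) (y m - a).
  have h2 := ler_normD (Z w - y n) (y n - b).
  by move: hp hm hn ha hb; set r := p.+1%:R^-1; lra.
apply: bigcupT_measurable => m; apply: bigcupT_measurable => n.
apply: bigcupT_measurable => p; rewrite /E.
case: (pselect (good m n p)) => g /=; last exact: measurable0.
by apply: measurableI; [apply: mY|apply: mZ]; exact: ball_open.
Qed.

Lemma borel_meas_comp (Y : Omega -> V) (g : V -> R) : continuous g ->
  borel_meas Y -> measurable_fun setT (g \o Y).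
Proof.
move=> cg mY; apply: (measurability _ (RGenOpens.measurableE R)).
move=> _ [_ [a [b ->] <-]]; rewrite setTI.
rewrite comp_preimage; apply: mY; move/continuousP : cg; apply.
exact: interval_open.
Qed.

(** Preimages of balls around a dense sequence, made disjoint. The sigma-algebra on [Omega] is
    arbitrary, so the cells can be taken in the past. *)
Lemma borel_cells (S : Omega -> V) (eta : R) : separable_space (V := V) ->
  borel_meas S -> 0 < eta ->
  exists (y : nat -> V) (A : nat -> set Omega),
    [/\ forall m, measurable (A m), trivIset setT A, \bigcup_m A m = setT &
        forall m w, A m w -> `|S w - y m| < eta].
Proof.
move=> /dense_sequence[y yd] mS eta0.
pose F m := S @^-1` ball (y m) eta.
exists y, (seqDU F); split.
- apply: seqDU_measurable => m; apply: mS; exact: ball_open.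
- exact: trivIset_seqDU.
- rewrite -seqDU_bigcup_eq; apply/seteqP; split => // w _.
  have [m hm] := yd (S w) _ eta0; exists m => //.
  by rewrite /F/= -ball_normE/= distrC.
- move=> m w h; have : F m w by exact: subset_seqDU h.
  by rewrite /F/= -ball_normE/= distrC.
Qed.

End borel.

(** Removes the discretisation factor in [cosh_step]. For finite [I], use exp (-x) >= 1 - x at x = e
    / (I + 1). *)
Lemma le_expR_eps (R : realType) (I J : \bar R) : (0 <= I)%E -> (0 <= J)%E ->
  (forall e : R, 0 < e -> (I <= (expR e)%:E * J)%E) -> (I <= J)%E.
Proof.
move=> I0; case: J => [r| |] J0 H; [|by rewrite leey|by []].
have := H 1 ltr01; case: I I0 H => [i| |] I0 H; [move=> _|by []|by []].
rewrite lee_fin in I0.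
rewrite lee_fin; apply/ler_addgt0Pr => e e0.
have i1 : 0 < i + 1 by rewrite ltr_wpDl.
have ei : 0 < e / (i + 1) by rewrite divr_gt0.
have := H _ ei; rewrite -EFinM lee_fin mulrC -ler_pdivrMr ?expR_gt0// -expRN => h.
have h2 := expR_ge1Dx (- (e / (i + 1))).
have h3 : i * (e / (i + 1)) <= e by rewrite mulrCA ger_pMr// ler_pdivrMr// mul1r lerDl.
nra.
Qed.

(** * One step of the recursion *)

Section step.
Context {R : realType} {V : normedModType R}
  {d : measure_display} {Omega : measurableType d}.
Variable P : probability Omega R.
Variables A1 A2 : R.
Hypothesis HA : assumption_A1 (V := V) A1 A2.
Hypothesis Vsep : separable_space (V := V).

Definition cosh_mean (lam : R) (S : Omega -> V) : \bar R :=
  (\int[P]_w (cosh (lam * `|S w|))%:E)%E.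

Lemma measurable_cosh_norm (lam : R) (S : Omega -> V) : borel_meas S ->
  measurable_fun setT (fun w => cosh (lam * `|S w|)).
Proof.
move=> mS; apply: (@borel_meas_comp _ _ _ _ S (fun v => cosh (lam * `|v|))) => // v.
have h : {for lam * `|v|, continuous (@cosh R)}.
  by apply: differentiable_continuous; apply/derivable1_diffP; exact: ex_derive.
apply: (@continuous_comp _ _ _ (fun v : V => lam * `|v|) (@cosh R)) => //.
apply: continuousM; first exact: cst_continuous.
exact: norm_continuous.
Qed.

(** Integrates [cosh_norm_taylor] over [A] at a deterministic [y]. One-sided bounds on the integrals
    suffice because the coefficients are nonnegative; sinh <= cosh then makes every term a multiple
    of cosh (lam |y|). *)
Lemma cosh_cell_le (lam c b v : R) (A : set Omega) (y : V) (Y : Omega -> V) :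
  0 < lam -> 0 <= b -> (forall w, `|Y w| <= c) -> lam * c <= 1 ->
  borel_meas Y -> measurable A ->
  (forall s, in_dual_ball1 s -> \int[P]_(w in A) (s (Y w))%:E <= b%:E * P A)%E ->
  (\int[P]_(w in A) (`|Y w| ^+ 2)%:E <= v%:E * P A)%E ->
  (\int[P]_(w in A) (cosh (lam * `|y + Y w|))%:E <=
   (1 + 4 * (A1 ^+ 2 + A2) * lam ^+ 2 * v + lam * b)%:E
     * ((cosh (lam * `|y|))%:E * P A))%E.
Proof.
move=> lam0 b0 Yc lamc mY mA Hs Hv.
have [A1ge [A2gt _]] := HA.
have [s sd sY] := cosh_norm_taylor HA y lam0.
have [[_ [_ sc]] sle] := sd.
have mYy : borel_meas (fun w => y + Y w).
  by apply: borel_measD => //; exact: borel_meas_cst.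
pose a0 := cosh (lam * `|y|); pose a1 := lam * sinh (lam * `|y|).
pose a2 := 4 * (A1 ^+ 2 + A2) * lam ^+ 2 * a0.
have a00 : 0 < a0 by exact: cosh_gt0.
have a10 : 0 <= a1.
  by apply: (mulr_ge0 (ltW lam0)); apply: sinh_ge0; rewrite mulr_ge0// ltW.
have a20 : 0 <= a2.
  apply: mulr_ge0 (ltW a00); apply: mulr_ge0 (sqr_ge0 _).
  by have := sqr_ge0 A1; lra.
have int (f : Omega -> R) (M : R) : measurable_fun setT f -> (forall w, `|f w| <= M) ->
    P.-integrable A (EFin \o f).
  move=> mf fM; apply: (integrableS measurableT mA (@subsetT _ _)).
  exact: bounded_integrable mf fM.
have int1 : P.-integrable A (EFin \o (s \o Y)).
  apply: (int _ c); first exact: borel_meas_comp.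
  by move=> w; rewrite (le_trans (sle _)).
have cc : continuous (fun v : V => `|v| ^+ 2).
  move=> x; apply: (@continuous_comp _ _ _ (fun v : V => `|v|) (fun r : R => r ^+ 2)).
    exact: norm_continuous.
  exact: exprn_continuous.
have int2 : P.-integrable A (EFin \o (fun w => `|Y w| ^+ 2)).
  apply: (int _ (c ^+ 2)); first exact: (borel_meas_comp cc mY).
  by move=> w; rewrite ger0_norm ?sqr_ge0// lerXn2r ?nnegrE// (le_trans _ (Yc w)).
have intc : P.-integrable A (EFin \o cst a0) by exact: finite_measure_integrable_cst.
have int1' := @integrableZl _ _ _ P A mA a1 _ int1.
have int2' := @integrableZl _ _ _ P A mA a2 _ int2.
have int3 : P.-integrable A (EFin \o (fun w => cosh (lam * `|y + Y w|))).
  apply: (int _ (cosh (lam * (`|y| + c)))); first exact: measurable_cosh_norm.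
  move=> w; rewrite ger0_norm; last exact/ltW/cosh_gt0.
  apply: ler_cosh; first by rewrite mulr_ge0// ltW.
  by rewrite ler_pM2l// (le_trans (ler_normD _ _))// lerD2l.
apply: (@le_trans _ _ (\int[P]_(w in A)
    (a0%:E + a1%:E * (s (Y w))%:E + a2%:E * (`|Y w| ^+ 2)%:E))%E).
  apply: le_integral => //.
    by apply: integrableD => //; exact: integrableD.
  move=> w _; rewrite -!EFinM -!EFinD lee_fin.
  have lY : lam * `|Y w| <= 1.
    by rewrite (le_trans _ lamc)// ler_pM2l.
  apply: (le_trans (sY (Y w) lY)); rewrite lerD2l /a2 exprMn.
  by rewrite le_eqVlt; apply/orP; left; apply/eqP; rewrite -/a0; ring.
rewrite integralD//; last exact: integrableD.
rewrite integralD// (@integral_cst _ _ _ P A mA a0%:E).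
rewrite (integralZl mA int1) (integralZl mA int2).
have PA : P A \is a fin_num by exact: fin_num_measure.
apply: (@le_trans _ _ (a0%:E * P A + a1%:E * (b%:E * P A) + a2%:E * (v%:E * P A))%E).
  apply: leeD; [apply: leeD => //|]; apply: lee_wpmul2l; rewrite ?lee_fin//.
  exact: Hs.
rewrite -(fineK PA) -!EFinM -!EFinD lee_fin.
have p0 : 0 <= fine (P A) by rewrite fine_ge0.
have h : a1 * b <= lam * b * a0.
  rewrite /a1 (mulrAC lam b) ler_wpM2r// ler_pM2l//.
  exact: sinh_le_cosh.
rewrite mulrA [_ * (v * _)]mulrA -!mulrDl mulrA ler_wpM2r// /a2 -/a0.
lra.
Qed.

Let coshE_ge0 (x : R) : (0 <= (cosh x)%:E)%E.
Proof. by rewrite lee_fin ltW// cosh_gt0. Qed.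

Local Hint Resolve coshE_ge0 : core.

(* Cutting the range of S into countably many cells of diameter at most eta
   replaces S by a constant on each cell, at the cost of a factor
   exp (2 lam eta); eta is arbitrary.  This way mixing is only applied to
   deterministic functionals. *)
Lemma cosh_step (G0 : set (set Omega)) (lam c b v : R) (S Y : Omega -> V) :
  0 < lam -> 0 <= b -> 0 <= v -> (forall w, `|Y w| <= c) -> lam * c <= 1 ->
  G0 `<=` measurable ->
  @borel_meas _ _ _ (g_sigma_algebraType G0) S -> borel_meas Y ->
  (forall A s, <<s G0 >> A -> in_dual_ball1 s ->
     \int[P]_(w in A) (s (Y w))%:E <= b%:E * P A)%E ->
  (forall A, <<s G0 >> A ->
     \int[P]_(w in A) (`|Y w| ^+ 2)%:E <= v%:E * P A)%E ->
  (cosh_mean lam (fun w => (S w + Y w)%R) <=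
   (1 + 4 * (A1 ^+ 2 + A2) * lam ^+ 2 * v + lam * b)%:E * cosh_mean lam S)%E.
Proof.
move=> lam0 b0 v0 Yc lamc G0m mS mY Hs Hv.
have [A1ge [A2gt _]] := HA.
have Gm : <<s G0 >> `<=` @measurable _ Omega.
  by apply: smallest_sub => //; exact: sigma_algebra_measurable.
have mSO : borel_meas S by move=> U oU; apply: Gm; exact: mS.
set K := 1 + _ + _.
have K0 : 0 <= K.
  rewrite /K !addr_ge0// ?mulr_ge0// ?sqr_ge0// ?(ltW lam0)//.
  by rewrite addr_ge0 ?sqr_ge0// ltW.
have cint (S' : Omega -> V) A :
    (0 <= \int[P]_(w in A) (cosh (lam * `|S' w|))%:E)%E.
  by apply: integral_ge0.
have mcosh (S' : Omega -> V) : borel_meas S' ->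
    measurable_fun setT (fun w : Omega => (cosh (lam * `|S' w|))%:E).
  move=> mS'; have := measurable_cosh_norm lam mS'.
  by move=> /measurable_EFinP.
have scal (S' : Omega -> V) (D : set Omega) (k : R) :
    measurable D -> borel_meas S' -> 0 <= k ->
    (\int[P]_(w in D) (k%:E * (cosh (lam * `|S' w|))%:E) =
     k%:E * \int[P]_(w in D) (cosh (lam * `|S' w|))%:E)%E.
  move=> mD mS' k0; apply: ge0_integralZl => //.
  by apply: measurable_funTS; exact: mcosh.
apply: le_expR_eps.
- exact: cint.
- by apply: mule_ge0; [rewrite lee_fin|exact: cint].
(* [S] is replaced by the centre of its cell and later restored; each exchange costs exp (lam eta) =
   exp (e / 2). *)
move=> e e0; pose eta := e / (2 * lam).
have eta0 : 0 < eta by rewrite divr_gt0// mulr_gt0.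
(* The cells belong to the sigma-algebra of the past, for which [S] is Borel, so [Hs] and [Hv] apply
   to each of them. *)
have [y [A [mA tA UA SA]]] : exists (y : nat -> V) (A : nat -> set Omega),
    [/\ forall m, <<s G0 >> (A m), trivIset setT A, \bigcup_m A m = setT &
        forall m w, A m w -> `|S w - y m| < eta].
  exact: (borel_cells Vsep mS eta0).
have mAO m : @measurable _ Omega (A m) := Gm _ (mA m).
have Dcosh (S1 S2 : V) : `|S1 - S2| <= eta ->
    cosh (lam * `|S1|) <= expR (e / 2) * cosh (lam * `|S2|).
  move=> h; apply: (le_trans (cosh_lip _ (lam * `|S2|))).
  rewrite mulrC ler_wpM2r ?(ltW (cosh_gt0 _))// ler_expR -mulrBr normrM.
  rewrite (gtr0_norm lam0) (le_trans (ler_wpM2l (ltW lam0) (ler_dist_dist _ _)))//.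
  rewrite (le_trans (ler_wpM2l (ltW lam0) h))// /eta le_eqVlt.
  by apply/orP; left; apply/eqP; field; rewrite gt_eqF.
have cell m : (\int[P]_(w in A m) (cosh (lam * `|S w + Y w|))%:E <=
    ((expR e)%:E * K%:E) * \int[P]_(w in A m) (cosh (lam * `|S w|))%:E)%E.
  have mSY : borel_meas (fun w => S w + Y w) by exact: borel_measD.
  have myY : borel_meas (fun w => y m + Y w).
    by apply: borel_measD => //; exact: borel_meas_cst.
  apply: (@le_trans _ _ (\int[P]_(w in A m)
      ((expR (e / 2))%:E * (cosh (lam * `|y m + Y w|))%:E))%E).
    apply: ge0_le_integral => //.
    - exact: measurable_funTS (mcosh _ mSY).
    - by apply: measurable_funeM; exact: measurable_funTS (mcosh _ myY).
    - move=> w Aw; rewrite -EFinM lee_fin; apply: Dcosh.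
      by rewrite opprD addrACA subrr addr0 ltW// SA.
  rewrite (scal (fun w => y m + Y w))// ?expR_ge0//.
  have h1 := @cosh_cell_le lam c b v (A m) (y m) Y lam0 b0 Yc lamc mY (mAO m)
    (fun s => Hs (A m) s (mA m)) (Hv (A m) (mA m)).
  apply: (le_trans (lee_wpmul2l _ h1)); first by rewrite lee_fin expR_ge0.
  have h2 : ((cosh (lam * `|y m|))%:E * P (A m) <=
     (expR (e / 2))%:E * \int[P]_(w in A m) (cosh (lam * `|S w|))%:E)%E.
    rewrite -(@integral_cst _ _ _ P _ (mAO m)) -scal// ?expR_ge0//.
    apply: ge0_le_integral => //.
    - by move=> w _; exact: coshE_ge0.
    - by apply: measurable_funeM; exact: measurable_funTS (mcosh _ mSO).
    - move=> w Aw; rewrite -EFinM lee_fin; apply: Dcosh.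
      by rewrite distrC ltW// SA.
  apply: (le_trans (lee_wpmul2l _ (lee_wpmul2l _ h2))); rewrite ?lee_fin ?expR_ge0//.
  by rewrite !muleA -!EFinM -mulrA (mulrC K) mulrA -expRD -splitr.
have mSY : borel_meas (fun w => S w + Y w) by exact: borel_measD.
rewrite /cosh_mean -UA ge0_integral_bigcup//; last by rewrite UA; exact: mcosh.
rewrite ge0_integral_bigcup//; last by rewrite UA; exact: mcosh.
rewrite muleA -EFinM -nneseriesZl; last by move=> i _; exact: cint.
apply: lee_nneseries => [i _ _|i _]; first exact: (cint (fun w => S w + Y w)).
by rewrite EFinM; exact: cell.
Qed.

End step.

(** * Residue classes and choice of the rate *)

Section residue_classes.

(* The number of j with j * k + r < n, when r < n. *)
Definition class_size (n k r : nat) : nat := ((n - r.+1) %/ k).+1.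

Lemma ltn_class_size (n k r j : nat) : (0 < k)%N -> (r < n)%N ->
  (j < class_size n k r)%N = (j * k + r < n)%N.
Proof.
move=> k0 rn; rewrite /class_size ltnS leq_divRL//.
by rewrite leq_subRL// addSn addnC.
Qed.

Lemma sum_blocks (M : nmodType) (f : nat -> M) (k m : nat) :
  \sum_(0 <= i < m * k) f i = \sum_(0 <= j < m) \sum_(0 <= r < k) f (j * k + r)%N.
Proof.
elim: m => [|m IH]; first by rewrite !big_nil.
rewrite big_nat_recr//= -IH mulSn addnC (big_cat_nat _ (leq_addr k (m * k)))//=.
congr (_ + _); rewrite -{1}[(m * k)%N]add0n.
by rewrite big_addn addKn; apply: eq_bigr => i _; rewrite addnC.
Qed.

(** Padding [f] by zeros up to n k makes all blocks complete; after exchanging the sums the padding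
    is cut off in each class. *)
Lemma sum_residue_classes (M : nmodType) (f : nat -> M) (n k : nat) :
  (0 < k <= n)%N ->
  \sum_(0 <= i < n) f i =
  \sum_(0 <= r < k) \sum_(0 <= j < class_size n k r) f (j * k + r)%N.
Proof.
move=> /andP[k0 kn].
pose g i := if (i < n)%N then f i else 0.
have nk : (n <= n * k)%N by rewrite leq_pmulr.
transitivity (\sum_(0 <= i < n * k) g i).
  rewrite (big_cat_nat _ nk)//= [X in _ = _ + X]big_nat_cond.
  rewrite [X in _ = _ + X]big1 ?addr0; last first.
    by move=> i /andP[/andP[ni _] _]; rewrite /g ltnNge ni.
  by apply: eq_big_nat => i /andP[_ ilt]; rewrite /g ilt.
rewrite sum_blocks exchange_big_nat/=; apply: eq_big_nat => r /andP[_ rk].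
have rn : (r < n)%N by exact: leq_trans kn.
have Nn : (class_size n k r <= n)%N.
  rewrite leqNgt; apply/negP => h.
  have := ltn_class_size n k0 rn; rewrite h => /esym.
  by rewrite ltnNge (leq_trans (leq_pmulr n k0))// leq_addr.
rewrite (big_cat_nat _ Nn)//= [X in _ + X]big_nat_cond.
rewrite [X in _ + X]big1 ?addr0; last first.
  move=> i /andP[/andP[ni _] _]; rewrite /g -(ltn_class_size _ k0 rn).
  by rewrite ltnNge ni.
by apply: eq_big_nat => i /andP[_ ilt]; rewrite /g -(ltn_class_size _ k0 rn) ilt.
Qed.

Lemma sum_class_size (n k : nat) : (0 < k <= n)%N ->
  (\sum_(0 <= r < k) class_size n k r = n)%N.
Proof.
move=> kn; have := sum_residue_classes (fun=> 1%N) kn.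
rewrite sum_nat_const_nat subn0 muln1 => {2}->.
by apply: eq_bigr => r _; rewrite sum_nat_const_nat subn0 muln1.
Qed.

(** With k = n %/ l and r < k, already (l - 1) k + r < l k <= n. *)
Lemma leq_class_size (n l r : nat) : (0 < l <= n)%N -> (r < n %/ l)%N ->
  (l <= class_size n (n %/ l) r)%N.
Proof.
move=> /andP[l0 ln] rk; have k0 : (0 < n %/ l)%N by rewrite divn_gt0.
have lkn : (n %/ l * l <= n)%N by exact: leq_divM.
have rn : (r < n)%N by rewrite (leq_trans rk)// leq_div.
rewrite -[X in (X <= _)%N](prednK l0) ltn_class_size//.
apply: leq_trans lkn; rewrite -[X in (_ < _ * X)%N](prednK l0) mulnS addnC.
by rewrite (mulnC l.-1) ltn_add2r.
Qed.

End residue_classes.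

(** * Jensen's inequality, the exponential rate and the threshold *)

Section real_bounds.
Context {R : realType}.

(** Average the tangent-line bound for exp at the weighted mean [a]; the linear part averages to
    0. *)
Lemma expR_jensen (I : Type) (s : seq I) (w y : I -> R) :
  (forall i, 0 <= w i) -> \sum_(i <- s) w i = 1 ->
  expR (\sum_(i <- s) w i * y i) <= \sum_(i <- s) w i * expR (y i).
Proof.
move=> w0 w1; set a := \sum_(i <- s) w i * y i.
have h : \sum_(i <- s) w i * (expR a * (1 + (y i - a))) = expR a.
  under eq_bigr do rewrite mulrCA.
  rewrite -mulr_sumr; under eq_bigr do rewrite mulrDr mulrBr mulr1.
  rewrite big_split/= w1 sumrB -/a -mulr_suml w1 mul1r subrr addr0 mulr1//.
rewrite -[leLHS]h; apply: ler_sum => i _; apply: ler_wpM2l => //.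
have -> : expR (y i) = expR a * expR (y i - a) by rewrite -expRD addrC subrK.
by rewrite ler_pM2l ?expR_gt0// expR_ge1Dx.
Qed.

(** Take for [mu] the smaller of sqrt (nu / W) and [L]. Either way W mu^2 <= nu and mu T >= 2 nu,
    the latter by the matching lower bound on [T]. *)
Lemma exists_rate (W nu T L : R) : 0 < W -> 1 <= nu -> 0 < L ->
  2 * nu / L <= T -> 4 * nu * W <= T ^+ 2 ->
  exists2 mu, 0 < mu <= L & W * mu ^+ 2 - mu * T <= - nu.
Proof.
move=> W0 nu1 L0 TL TW.
have nu0 : 0 < nu by lra.
have T0 : 0 < T by apply: lt_le_trans TL; rewrite !mulr_gt0// invr_gt0.
have nW0 : 0 < nu / W by rewrite divr_gt0.
pose mu := Num.sqrt (nu / W).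
have mu0 : 0 < mu by rewrite sqrtr_gt0.
have mu2 : W * mu ^+ 2 = nu.
  by rewrite sqr_sqrtr ?(ltW nW0)// mulrC divfK// gt_eqF.
have [muL|Lmu] := leP mu L.
  exists mu; first by rewrite mu0.
  have : (2 * nu) ^+ 2 <= (mu * T) ^+ 2.
    rewrite [leRHS]exprMn; apply: (le_trans _ (ler_wpM2l (sqr_ge0 mu) TW)).
    rewrite (_ : mu ^+ 2 * (4 * nu * W) = 4 * nu * (W * mu ^+ 2)); last by ring.
    by rewrite mu2 le_eqVlt; apply/orP; left; apply/eqP; ring.
  rewrite ler_sqr ?nnegrE ?mulr_ge0 ?(ltW mu0) ?(ltW T0) ?(ltW nu0)//.
  rewrite mu2; lra.
exists L; first by rewrite L0 lexx.
have h1 : W * L ^+ 2 <= nu.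
  rewrite -mu2 ler_pM2l// lerXn2r ?nnegrE ?(ltW L0) ?(ltW mu0) ?(ltW Lmu)//.
have h2 : 2 * nu <= L * T by rewrite (mulrC L) -ler_pdivrMr.
lra.
Qed.

(* To be read with u = sigma / sqrt l, p = c / l, r = C2 / (C1 c) and
   b = C1 q, where q bounds the mixing coefficient. *)
Lemma threshold_bounds (A1 B u p r b nu T : R) :
  1 <= A1 -> 0 <= B -> 0 < u -> 0 < p -> 0 <= r -> 1 <= nu -> 0 <= b ->
  b <= Num.max p u ->
  T = u * (4 * A1 + 6 * Num.sqrt B * Num.sqrt nu)
    + p * (4 * A1 + (2 + 2 * Num.sqrt B * (1 + 2 * r)) * nu) - b ->
  2 * nu * p <= T /\ 4 * nu * (4 * B * (u ^+ 2 + r * p * b)) <= T ^+ 2.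
Proof.
move=> A1ge B0 u0 p0 r0 nu1 b0 bmax TE.
have bpu : b <= p + u.
  by apply: (le_trans bmax); rewrite ge_max; apply/andP; split; lra.
have nu0 : 0 <= nu by lra.
set sB := Num.sqrt B in TE; set sn := Num.sqrt nu in TE.
have sB0 : 0 <= sB by exact: sqrtr_ge0.
have sn0 : 0 <= sn by exact: sqrtr_ge0.
have sB2 : sB ^+ 2 = B by rewrite sqr_sqrtr.
have sn2 : sn ^+ 2 = nu by rewrite sqr_sqrtr.
have sn1 : 1 <= sn by rewrite -sqrtr1 ler_sqrt.
have snnu : sn <= nu by rewrite -sn2 expr2; nra.
(* The terms 4 A1 u + 4 A1 p pay for the subtracted b <= p + u. *)
have T1 : 6 * sB * sn * u + 2 * nu * p + (sB * (2 + 4 * r)) * nu * p <= T.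
  have h1 : u <= A1 * u by rewrite ler_peMl// ltW.
  have h2 : p <= A1 * p by rewrite ler_peMl// ltW.
  rewrite TE; nra.
have q0 : 0 <= 6 * sB * sn * u by rewrite !mulr_ge0// ltW.
have q1 : 0 <= sB * (2 + 4 * r) * p.
  by rewrite !mulr_ge0 ?(ltW p0)//; lra.
have q2 : sB * (2 + 4 * r) * p * sn <= sB * (2 + 4 * r) * p * nu.
  by rewrite ler_wpM2l.
have np0 : 0 <= 2 * nu * p by rewrite !mulr_ge0// ltW.
have q3 : 0 <= sB * (2 + 4 * r) * p * sn by rewrite mulr_ge0.
split; first lra.
have T2 : sB * sn * (6 * u + (2 + 4 * r) * p) <= T by lra.
have T20 : 0 <= sB * sn * (6 * u + (2 + 4 * r) * p).
  by rewrite !mulr_ge0// addr_ge0// ?mulr_ge0 ?(ltW u0) ?(ltW p0)//; lra.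
apply: (@le_trans _ _ ((sB * sn * (6 * u + (2 + 4 * r) * p)) ^+ 2)); last first.
  by rewrite ler_sqr ?nnegrE//; exact: le_trans T2.
rewrite !exprMn sB2 sn2.
rewrite (_ : 4 * nu * _ = B * nu * (16 * (u ^+ 2 + r * p * b))); last by ring.
apply: ler_wpM2l; first by rewrite mulr_ge0.
(* With b <= p + u, the coefficients of u^2, u p and p^2 can be compared: 16 <= 36, 16 r <= 12 (2 +
   4 r) and 16 r <= (2 + 4 r)^2. *)
have h : r * p * b <= r * p * (p + u) by rewrite ler_wpM2l// mulr_ge0// ltW.
have up0 : 0 <= u * p by rewrite mulr_ge0// ltW.
have rup0 : 0 <= r * (u * p) by rewrite mulr_ge0.
have rp0 : 0 <= (r * p) ^+ 2 by exact: sqr_ge0.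
have pp0 : 0 <= p ^+ 2 by exact: sqr_ge0.
have uu0 : 0 <= u ^+ 2 by exact: sqr_ge0.
nra.
Qed.

End real_bounds.

(** * Chernoff bound *)

Lemma borel_meas_sum {R : realType} {V : normedModType R}
  {d : measure_display} {Omega : measurableType d} (Z : nat -> Omega -> V) (N : nat) :
  separable_space (V := V) -> (forall j, (j < N)%N -> borel_meas (Z j)) ->
  borel_meas (fun w => \sum_(0 <= j < N) Z j w).
Proof.
move=> Vsep; elim: N => [|N IH] mZ.
  rewrite (_ : (fun w => _) = fun=> 0); first exact: borel_meas_cst.
  by apply/funext => w; rewrite big_nil.
rewrite (_ : (fun w => _) = fun w => \sum_(0 <= j < N) Z j w + Z N w).
  apply: borel_measD => //; last exact: mZ.
  by apply: IH => j jN; apply: mZ; rewrite ltnS ltnW.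
by apply/funext => w; rewrite big_nat_recr.
Qed.

Section classes.
Context {R : realType} {V : normedModType R}
  {d : measure_display} {Omega : measurableType d}.
Variables (P : probability Omega R) (X : nat -> Omega -> V).
Variables (c sigma A1 A2 C1 C2 q : R) (Cc : set (V -> R)) (Cs : (V -> R) -> R).
Variable k : nat.
Hypothesis Vsep : separable_space (V := V).
Hypothesis mX : forall i, (1 <= i)%N -> borel_meas (X i).
Hypothesis Xc : forall i w, (1 <= i)%N -> `|X i w| <= c.
Hypothesis EX : forall i s, (1 <= i)%N -> is_dual s -> expect P (s \o X i) = 0.
Hypothesis HC : function_class c Cc Cs.
Hypothesis mC : forall phi i, Cc phi -> (1 <= i)%N ->
  measurable_fun setT (phi \o X i).
Hypothesis HA : assumption_A1 (V := V) A1 A2.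
Hypothesis X2 : forall i, (1 <= i)%N ->
  (\int[P]_w (`|X i w| ^+ 2)%:E <= (sigma ^+ 2)%:E)%E.
Hypothesis dualC : forall s : V -> R, is_dual s -> Cc (restrictX c s).
Hypothesis sqrC : Cc (restrictX c (fun x : V => `|x| ^+ 2)).
Hypothesis dualC1 : forall s : V -> R, in_dual_ball1 s -> Cs (restrictX c s) <= C1.
Hypothesis sqrC2 : Cs (restrictX c (fun x : V => `|x| ^+ 2)) <= C2.
Hypothesis C10 : 0 < C1.
Hypothesis C20 : 0 <= C2.
Hypothesis q0 : 0 <= q.
Hypothesis mixq : (mixing_coeff P Cc Cs X k <= q%:E)%E.

Let v := sigma ^+ 2 + C2 * q.
Let v0 : 0 <= v.
Proof. by rewrite addr_ge0 ?sqr_ge0// mulr_ge0. Qed.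
Let b0 : 0 <= C1 * q.
Proof. by rewrite mulr_ge0// ltW. Qed.

Definition class_sum (i N : nat) (w : Omega) : V :=
  \sum_(0 <= j < N) X (i + j * k) w.

(** Induction on [N]: every further element of the class contributes one factor through [cosh_step],
    its past ending [k] indices earlier. *)
Lemma cosh_mean_class_sum (lam : R) (i N : nat) : (1 <= i)%N ->
  0 < lam -> lam * c <= 1 ->
  (cosh_mean P lam (class_sum i N) <=
   ((1 + 4 * (A1 ^+ 2 + A2) * lam ^+ 2 * v + lam * (C1 * q)) ^+ N)%:E)%E.
Proof.
move=> i1 lam0 lamc; set K := 1 + _ + _.
have K0 : 0 <= K.
  have [A1ge [A2gt _]] := HA.
  have h1 : 0 <= 4 * (A1 ^+ 2 + A2) * lam ^+ 2 * v.
    apply: mulr_ge0 v0; apply: mulr_ge0 (sqr_ge0 _).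
    by have := sqr_ge0 A1; lra.
  have h2 : 0 <= lam * (C1 * q) by rewrite mulr_ge0// ltW.
  rewrite /K; lra.
elim: N => [|N IH].
  rewrite expr0 /cosh_mean (eq_integral (cst 1%E)) ?integral_cst//=.
    by rewrite probability_setT mul1e.
  by move=> w _; rewrite /class_sum big_nil normr0 mulr0 cosh0.
(* The first element has no predecessor in its class; centring and the second moment bound replace
   mixing, with y = 0 on the whole space. *)
case: N IH => [_|N IH].
  have h := @cosh_cell_le R V d Omega P A1 A2 HA Vsep lam c (C1 * q) v setT 0 (X i)
    lam0 b0 (fun w => Xc w i1) lamc (mX i1) measurableT.
  rewrite normr0 mulr0 cosh0 mul1e probability_setT !mule1 -/K in h.
  rewrite /cosh_mean expr1 (eq_integral (fun w => (cosh (lam * `|0 + X i w|))%:E)).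
    apply: h => [s sd|].
      have ints := class_integrable P HC mC (dualC sd.1) i1.
      have e w : restrictX c s (X i w) = s (X i w) by rewrite /restrictX Xc.
      have ints' : P.-integrable setT (EFin \o (s \o X i)).
        by move: ints; rewrite (_ : restrictX c s \o X i = s \o X i)//; exact/funext.
      have := EX i1 sd.1; rewrite /expect => h0.
      rewrite -[leLHS](fineK (integrable_fin_num measurableT ints')) lee_fin.
      by rewrite h0.
    by apply: (le_trans (X2 i1)); rewrite lee_fin lerDl mulr_ge0.
  by move=> w _; rewrite /class_sum big_nat1 mul0n addn0 add0r.
(* Last index of the sum of N + 1 elements: that sum is measurable for the filtration at [i'], and
   the next element has index i' + k. *)
pose i' := (i + N * k)%N.
have i'1 : (1 <= i')%N by rewrite addn_gt0 i1.
have i'k : (i' + k)%N = (i + N.+1 * k)%N by rewrite /i' -addnA mulSn (addnC k).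
have i'k1 : (1 <= i' + k)%N by rewrite addn_gt0 i'1.
have -> : cosh_mean P lam (class_sum i N.+2) =
    cosh_mean P lam (fun w => class_sum i N.+1 w + X (i' + k)%N w).
  by congr cosh_mean; apply/funext => w; rewrite /class_sum big_nat_recr//= i'k.
apply: (@le_trans _ _ (K%:E * cosh_mean P lam (class_sum i N.+1))%E); last first.
  by rewrite exprS EFinM lee_wpmul2l// lee_fin.
apply: (@cosh_step R V d Omega P A1 A2 HA Vsep _ lam c (C1 * q) v _ _ lam0 b0 v0
  _ lamc (natural_filtration_measurable (i := i') mX)).
- by move=> w; exact: Xc.
- apply: borel_meas_sum => // j jN U oU; apply: sub_sigma_algebra.
  exists (i + j * k)%N, U; split => //; rewrite addn_gt0 i1/= leq_add2l.
  by rewrite leq_mul2r -ltnS jN orbT.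
- exact: mX.
- move=> A s FA sd.
  apply: (mixing_dual_le mX HC mC q0 mixq i'1 _ (ltW C10)) => //.
  + by move=> w; exact: Xc.
  + exact: dualC sd.1.
  + exact: dualC1.
  + exact: EX i'k1 sd.1.
- move=> A FA.
  apply: (mixing_sqr_le mX HC mC q0 mixq i'1) => //.
  + by move=> w; exact: Xc.
  + exact: X2.
Qed.

Lemma cosh_mean_class_sum_expR (lam : R) (i N : nat) : (1 <= i)%N ->
  0 < lam -> lam * c <= 1 ->
  (cosh_mean P lam (class_sum i N) <=
   (expR (N%:R * (4 * (A1 ^+ 2 + A2) * lam ^+ 2 * v + lam * (C1 * q))))%:E)%E.
Proof.
move=> i1 lam0 lamc; apply: (le_trans (cosh_mean_class_sum N i1 lam0 lamc)).
have [A1ge [A2gt _]] := HA.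
have h1 : 0 <= 4 * (A1 ^+ 2 + A2) * lam ^+ 2 * v.
  apply: mulr_ge0 v0; apply: mulr_ge0 (sqr_ge0 _).
  by have := sqr_ge0 A1; lra.
have h2 : 0 <= lam * (C1 * q) by rewrite mulr_ge0// ltW.
rewrite lee_fin expRM_natl lerXn2r ?nnegrE ?expR_ge0//; first lra.
by rewrite -addrA expR_ge1Dx.
Qed.

(* Chernoff bound: Jensen's inequality for exp distributes the mean over the
   residue classes modulo [k], each of which has at least [l] elements. *)
Lemma chernoff_mean (n l : nat) (mu t : R) : (0 < k <= n)%N -> (0 < l)%N ->
  (forall r, (r < k)%N -> (l <= class_size n k r)%N) ->
  0 < mu -> mu * c <= l%:R ->
  (P [set w | (t <= `| n%:R^-1 *: \sum_(1 <= i < n.+1) X i w |)%R] <=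
   (2 * expR (4 * (A1 ^+ 2 + A2) * v / l%:R * mu ^+ 2 + mu * (C1 * q) - mu * t))%:E)%E.
Proof.
move=> kn l0 lN mu0 muc.
have [A1ge [A2gt _]] := HA.
have n0 : (0 < n)%N by case/andP: kn => k0; exact: leq_trans.
have nR0 : 0 < n%:R :> R by rewrite ltr0n.
have lR0 : 0 < l%:R :> R by rewrite ltr0n.
pose N r := class_size n k r.
have NR0 r : 0 < (N r)%:R :> R by rewrite ltr0n.
pose m w := `| n%:R^-1 *: \sum_(1 <= i < n.+1) X i w |.
pose E := expR (4 * (A1 ^+ 2 + A2) * v / l%:R * mu ^+ 2 + mu * (C1 * q)).
(* Weights proportional to the class sizes; with the rates mu / N r below, each product
   [wt r * lam r] equals mu / n. *)
pose wt r : R := (N r)%:R / n%:R.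
have wt0 r : 0 <= wt r by rewrite divr_ge0// ltW.
have wt1 : \sum_(0 <= r < k) wt r = 1.
  rewrite -mulr_suml -natr_sum (sum_class_size kn) divff// gt_eqF//.
pose S r := class_sum r.+1 (N r).
pose lam r := mu / (N r)%:R.
have lam0 r : 0 < lam r by rewrite divr_gt0.
have bound w : expR (mu * m w) <=
    \sum_(0 <= r < k) 2 * wt r * cosh (lam r * `|S r w|).
  rewrite /m; have -> : \sum_(1 <= i < n.+1) X i w = \sum_(0 <= r < k) S r w.
    rewrite big_add1/= (sum_residue_classes (fun i => X i.+1 w) kn).
    apply: eq_bigr => r _; apply: eq_bigr => j _.
    by rewrite addnC addSn.
  apply: (@le_trans _ _ (expR (\sum_(0 <= r < k) wt r * (lam r * `|S r w|)))).
    rewrite ler_expR normrZ gtr0_norm ?invr_gt0// mulrA.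
    apply: (le_trans (ler_wpM2l _ (ler_norm_sum _ _ _))).
      by rewrite mulr_ge0 ?invr_ge0 ?ltW.
    rewrite mulr_sumr; apply: ler_sum => r _; rewrite mulrA.
    rewrite le_eqVlt; apply/orP; left; apply/eqP; rewrite /wt /lam.
    by field; rewrite !gt_eqF.
  apply: (le_trans (expR_jensen _ wt0 wt1)); apply: ler_sum => r _.
  (* exp x <= 2 cosh x: the origin of the factor 2 in the tail bound. *)
  rewrite -mulrA mulrCA; apply: ler_wpM2l => //; rewrite /cosh.
  by have := expR_gt0 (- (lam r * `|S r w|)); lra.
have mS r : borel_meas (S r).
  by apply: borel_meas_sum => // j _; exact: mX.
have mm : measurable [set w | t <= m w].
  have mM : borel_meas (fun w => \sum_(1 <= i < n.+1) X i w).
    rewrite (_ : (fun w => _) = fun w => \sum_(0 <= i < n) X i.+1 w).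
      by apply: borel_meas_sum => // j _; exact: mX.
    by apply/funext => w; rewrite big_add1.
  have : measurable_fun setT m.
    apply: (@borel_meas_comp _ _ _ _ _ (fun x : V => `|n%:R^-1 *: x|)) mM => x.
    apply: (@continuous_comp _ _ _ (fun x : V => n%:R^-1 *: x)).
      exact: scaler_continuous.
    exact: norm_continuous.
  move=> /(_ measurableT `[t, +oo[%classic) /(_ (measurable_itv _)).
  rewrite setTI (_ : _ @^-1` _ = [set w | t <= m w])//.
  by apply/seteqP; split => w /=; rewrite in_itv/= andbT.
have mcosh r : measurable_fun setT
    (fun w => (2 * wt r * cosh (lam r * `|S r w|))%:E).
  have h := measurable_cosh_norm (lam r) (mS r).
  have hc : measurable_fun (setT : set Omega) (cst (2 * wt r)) by [].
  by have /measurable_EFinP := measurable_funM hc h.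
have term0 r w : (0 <= (2 * wt r * cosh (lam r * `|S r w|))%:E)%E.
  by rewrite lee_fin !mulr_ge0// ltW// cosh_gt0.
have term r : (r < k)%N ->
    (\int[P]_w (2 * wt r * cosh (lam r * `|S r w|))%:E <= (2 * wt r * E)%:E)%E.
  move=> rk; under eq_integral do rewrite EFinM.
  rewrite ge0_integralZl//; last 3 first.
  - by have /measurable_EFinP := measurable_cosh_norm (lam r) (mS r).
  - by move=> w _; rewrite lee_fin ltW// cosh_gt0.
  - by rewrite lee_fin mulr_ge0.
  rewrite [leRHS]EFinM; apply: lee_wpmul2l; first by rewrite lee_fin mulr_ge0.
  have lN' : l%:R <= (N r)%:R :> R by rewrite ler_nat lN.
  have lamc : lam r * c <= 1.
    by rewrite /lam mulrAC ler_pdivrMr// mul1r (le_trans muc).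
  have := cosh_mean_class_sum_expR (N r) (ltn0Sn r) (lam0 r) lamc.
  move=> /le_trans; apply; rewrite lee_fin ler_expR.
  (* The linear term no longer depends on the class, and the quadratic one is largest when N r is
     replaced by its lower bound [l]. *)
  have -> : (N r)%:R * (4 * (A1 ^+ 2 + A2) * lam r ^+ 2 * v + lam r * (C1 * q)) =
    4 * (A1 ^+ 2 + A2) * v * mu ^+ 2 / (N r)%:R + mu * (C1 * q).
    by rewrite /lam; field; rewrite gt_eqF.
  rewrite lerD2r [leRHS]mulrAC ler_wpM2l//; last by rewrite lef_pV2 ?posrE.
  apply: mulr_ge0 (sqr_ge0 _); apply: mulr_ge0 v0.
  by have := sqr_ge0 A1; lra.
have key : ((expR (mu * t))%:E * P [set w | (t <= m w)%R] <= (2 * E)%:E)%E.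
  rewrite -(@integral_cst _ _ _ P _ mm).
  apply: (@le_trans _ _ (\int[P]_(w in [set w | (t <= m w)%R])
     (\sum_(0 <= r < k) (2 * wt r * cosh (lam r * `|S r w|))%:E))%E).
    apply: ge0_le_integral => //.
    - by move=> w _ /=; rewrite lee_fin expR_ge0.
    - by apply: measurable_funTS; exact: emeasurable_sum.
    - move=> w /= tm; rewrite sumEFin lee_fin (le_trans _ (bound w))//.
      by rewrite ler_expR ler_pM2l.
  apply: (@le_trans _ _ (\int[P]_w
     (\sum_(0 <= r < k) (2 * wt r * cosh (lam r * `|S r w|))%:E))%E).
    apply: ge0_subset_integral => //; first exact: emeasurable_sum.
    by move=> w _; exact: sume_ge0.
  rewrite ge0_integral_sum//.
  apply: (@le_trans _ _ (\sum_(0 <= r < k) (2 * wt r * E)%:E)%E).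
    by rewrite !big_mkord; apply: lee_sum => r _; exact: term.
  by rewrite sumEFin lee_fin -mulr_suml -mulr_sumr wt1 mulr1.
have PA : P [set w | t <= m w] \is a fin_num by exact: fin_num_measure.
move: key; rewrite -(fineK PA) -EFinM !lee_fin => key.
rewrite expRD expRN -/E mulrA ler_pdivlMr ?expR_gt0// mulrC.
exact: key.
Qed.

End classes.

(** * The tail bound at the effective sample size *)

Unset Implicit Arguments. Set Strict Implicit. Set Printing Implicit Defensive.

Theorem theorem3p2 (R : realType) (V : completeNormedModType R)
  (d : measure_display) (Omega : measurableType d) (P : probability Omega R)
  (X : nat -> Omega -> V) (c sigma A1 A2 C1 C2 : R)
  (Cc : set (V -> R)) (Cs : (V -> R) -> R) (n : nat) :
  (* setting *)
  separable_space (V := V) ->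
  0 < c ->
  (forall i, (1 <= i)%N -> borel_meas (X i)) ->
  (forall i w, (1 <= i)%N -> `|X i w| <= c) ->
  (forall i s, (1 <= i)%N -> is_dual s -> expect P (s \o X i) = 0) ->
  function_class c Cc Cs ->
  (forall phi i, Cc phi -> (1 <= i)%N -> measurable_fun setT (phi \o X i)) ->
  (* Assumption A1 *)
  assumption_A1 (V := V) A1 A2 ->
  (* Assumption A2 *)
  (* (the a.s. bound ||X_i|| <= c holds everywhere, by the hypothesis above) *)
  0 < sigma ->
  (forall i, (1 <= i)%N ->
     (\int[P]_w (`|X i w| ^+ 2)%:E <= (sigma ^+ 2)%:E)%E) ->
  (* Assumption A3 *)
  (forall s, is_dual s -> Cc (restrictX c s)) ->
  Cc (restrictX c (fun x : V => `|x| ^+ 2)) ->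
  (forall s, in_dual_ball1 s -> Cs (restrictX c s) <= C1) ->
  Cs (restrictX c (fun x : V => `|x| ^+ 2)) <= C2 ->
  0 < C1 -> 0 <= C2 ->
  (1 <= n)%N ->
  let lstar := eff_sample_size P Cc Cs X C1 c sigma n in
  let B := A1 ^+ 2 + A2 in
  let M1 := 2 + 2 * Num.sqrt B * (1 + 2 * C2 / (C1 * c)) in
  forall nu : R, 1 <= nu ->
  (P [set w | (sigma * (4 * A1 + 6 * Num.sqrt B * Num.sqrt nu)
                 / Num.sqrt lstar%:R
               + c * (4 * A1 + M1 * nu) / lstar%:R
              <= `| n%:R^-1 *: \sum_(1 <= i < n.+1) X i w |)%R ]
     <= (2 * expR (- nu))%:E)%E.
Proof.
move=> Vsep c0 mX Xc EX HC mC HA s0 X2 dualC sqrC dualC1 sqrC2 C10 C20 n1.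
move=> lstar B M1 nu nu1.
have [A1ge [A2gt _]] := HA.
have Bge1 : 1 <= B by rewrite /B; nra.
have B0 : 0 <= B by lra.
have nu0 : 0 <= nu by lra.
have M10 : 0 <= M1.
  have h : 0 <= 2 * C2 / (C1 * c).
    by apply: divr_ge0; apply: mulr_ge0 => //; exact: ltW.
  have := mulr_ge0 (sqrtr_ge0 B) h; have := sqrtr_ge0 B.
  by rewrite /M1; nra.
have nR0 : 0 < n%:R :> R by rewrite ltr0n.
have mean_le w : `| n%:R^-1 *: \sum_(1 <= i < n.+1) X i w | <= c.
  rewrite normrZ gtr0_norm ?invr_gt0// ler_pdivrMl//.
  apply: (le_trans (ler_norm_sum _ _ _)).
  apply: (@le_trans _ _ (\sum_(1 <= i < n.+1) c)).
    rewrite big_nat [leRHS]big_nat; apply: ler_sum => i /andP[i1 _]; exact: Xc.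
  by rewrite sumr_const_nat subSS subn0 mulr_natl.
(* When lstar = 1 the threshold exceeds c, which bounds the mean. *)
have [l1|l1] := eqVneq lstar 1%N.
  rewrite (_ : [set w | _] = set0) ?measure0 ?lee_fin ?mulr_ge0 ?expR_ge0//.
  rewrite -subset0 => w /=; apply/negP; rewrite -ltNge.
  apply: (le_lt_trans (mean_le w)).
  rewrite l1 sqrtr1 !divr1.
  have h1 : 0 <= sigma * (4 * A1 + 6 * Num.sqrt B * Num.sqrt nu).
    by rewrite mulr_ge0 ?(ltW s0)// addr_ge0 ?mulr_ge0 ?sqrtr_ge0//; lra.
  have h2 : 0 <= M1 * nu by exact: mulr_ge0.
  have h3 : 0 <= c * (M1 * nu) by rewrite mulr_ge0// ltW.
  nra.
(* Since [lstar] differs from 1, some [l] is admissible and the maximum is attained; an empty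
   maximum would be 0 and give lstar = 1. *)
have [l [ln lmix ->]] : exists l : nat, [/\ (0 < l <= n)%N,
   (C1%:E * mixing_coeff P Cc Cs X (n %/ l) <=
     (Num.max (c / l%:R) (sigma / Num.sqrt l%:R))%:E)%E & lstar = l].
  pose Q (l : 'I_n.+1) := (1 <= (l : nat))%N &&
     (C1%:E * mixing_coeff P Cc Cs X (n %/ l) <=
       (Num.max (c / (l : nat)%:R) (sigma / Num.sqrt (l : nat)%:R))%:E)%E.
  have lE : lstar = maxn 1 (\max_(l < n.+1 | Q l) l) by [].
  move: l1; rewrite lE; have [Q0|Q0] := posnP #|Q|.
    rewrite big1 ?maxn0// => i Qi.
    by have : i \in Q by []; rewrite (card0_eq Q0).
  have [i Qi ->] := eq_bigmax_cond (@nat_of_ord n.+1) Q0.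
  move: Qi; rewrite unfold_in => /andP[i1 imix] _.
  exists i; split => //; last by apply/maxn_idPr.
  by rewrite i1 -ltnS ltn_ord.
move: (ln) => /andP[l0 lln].
have lR0 : 0 < l%:R :> R by rewrite ltr0n.
have sl0 : 0 < Num.sqrt l%:R :> R by rewrite sqrtr_gt0.
pose k := (n %/ l)%N.
have k0 : (0 < k)%N by rewrite divn_gt0.
have kn : (0 < k <= n)%N by rewrite k0 leq_div.
pose p := c / l%:R; pose u := sigma / Num.sqrt l%:R.
have p0 : 0 < p by rewrite divr_gt0.
have u0 : 0 < u by rewrite divr_gt0.
(* [q] turns the defining condition of [lstar] into a real bound on the mixing coefficient, with C1
   q = b. *)
pose b := Num.max p u; pose q := b / C1.
have b0 : 0 < b by rewrite lt_max p0.
have q0 : 0 <= q by rewrite divr_ge0 ?ltW.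
have C1q : C1 * q = b by rewrite /q mulrC divfK// gt_eqF.
have mixq : (mixing_coeff P Cc Cs X k <= q%:E)%E.
  by rewrite /q mulrC EFinM lee_pdivlMl.
pose r := C2 / (C1 * c).
have r0 : 0 <= r by rewrite divr_ge0// mulr_ge0// ltW.
set t := sigma * _ / _ + _.
pose W := 4 * B * (sigma ^+ 2 + C2 * q) / l%:R.
have WE : W = 4 * B * (u ^+ 2 + r * p * b).
  rewrite /W /u /r /p expr_div_n sqr_sqrtr ?ler0n// -C1q.
  by field; rewrite !gt_eqF.
have W0 : 0 < W.
  rewrite WE; apply: mulr_gt0; first lra.
  apply: ltr_pwDl; first exact: exprn_gt0.
  exact: mulr_ge0 (mulr_ge0 r0 (ltW p0)) (ltW b0).
(* The Chernoff exponent is W mu^2 + mu b - mu t, so the rate is optimised for the reduced threshold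
   t - b. *)
have tE : t - b = u * (4 * A1 + 6 * Num.sqrt B * Num.sqrt nu)
    + p * (4 * A1 + (2 + 2 * Num.sqrt B * (1 + 2 * r)) * nu) - b.
  by rewrite /t /M1 /u /p /r; field; rewrite !gt_eqF.
have [T1 T2] := threshold_bounds A1ge B0 u0 p0 r0 nu1 (ltW b0) (lexx _) tE.
have L0 : 0 < l%:R / c by rewrite divr_gt0.
have TL : 2 * nu / (l%:R / c) <= t - b by rewrite invf_div.
rewrite -WE in T2.
have [mu /andP[mu0 muL] hmu] := exists_rate W0 nu1 L0 TL T2.
have muc : mu * c <= l%:R by rewrite -ler_pdivlMr.
have := @chernoff_mean R V d Omega P X c sigma A1 A2 C1 C2 q Cc Cs k Vsep mX Xc
  EX HC mC HA X2 dualC sqrC dualC1 sqrC2 C10 C20 q0 mixq n l mu t kn l0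
  (fun r rk => leq_class_size ln rk) mu0 muc.
move=> /le_trans; apply; rewrite lee_fin ler_pM2l// ler_expR.
move: hmu; rewrite C1q -/B -/W; lra.
Qed.
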